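(* Let $0<\alpha\le1$ and let $\{X_t\}_{t\ge 0}$ be the semi-Markov process on $\{1,\dots,p,p+1\}$ with Mittag-Leffler sojourn times described in the context, with states $1,\dots,p$ transient, state $p+1$ absorbing, initial distribution $\boldsymbol{\pi}=(\pi_1,\dots,\pi_p)$ on $\{1,\dots,p\}$, and associated matrix $$\boldsymbol{\Lambda}=\begin{pmatrix}\boldsymbol{T}&\boldsymbol{t}\\ \boldsymbol{0}&0\end{pmatrix}.$$ Let $\tau=\inf\{t\ge 0:\, X_t= p+1\}$ denote the time until absorption. Then $\tau$ has an $\mathrm{MML}(\alpha,\boldsymbol{\pi},\boldsymbol{T})$ distribution, with cumulative distribution function given by $$F_\tau(u)=1-\boldsymbol{\pi}\, E_{\alpha,1}(\boldsymbol{T} u^\alpha)\, \boldsymbol{e},\qquad u\ge 0.$$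
   Context: Mittag-Leffler function: $E_{\alpha,\beta}(z)=\sum_{k\ge0} z^k/\Gamma(\alpha k+\beta)$ for scalars, and $E_{\alpha,\beta}(\boldsymbol{A})=\sum_{k\ge0}\boldsymbol{A}^k/\Gamma(\alpha k+\beta)$ for square matrices $\boldsymbol{A}$. The vector $\boldsymbol{e}=(1,\dots,1)'$ is the $p$-dimensional column vector of ones and $\boldsymbol{I}$ is the identity matrix. Construction of the process. Let $\{Y_n\}_{n\ge0}$ be a Markov chain on $\{1,\dots,p,p+1\}$ with transition matrix $$\boldsymbol{Q}=(q_{ij})=\begin{pmatrix}\boldsymbol{Q}^1&\boldsymbol{q}^1\\ \boldsymbol{0}&1\end{pmatrix},$$ where $q_{ii}=0$ for $i\le p$, the states $1,\dots,p$ are transient and $p+1$ is absorbing, with $\mathbb{P}(Y_0=i)=\pi_i$ for $i\le p$, $\sum_{i=1}^p\pi_i=1$. Let $\lambda_1,\dots,\lambda_p>0$ and $\lambda_{p+1}=0$. For $i\le p$ and $n\ge1$ let $T^i_n$ be random variables with the Mittag-Leffler density $f_i(x)=\lambda_i x^{\alpha-1}E_{\alpha,\alpha}(-\lambda_i x^\alpha)$, $x>0$, all independent of each other and of $\{Y_n\}$; the sojourn time in state $p+1$ is infinite ($T^{p+1}_n=\infty$). Put $S_0=0$, $S_n=\sum_{m=1}^n T_m^{Y_{m-1}}$, and $X_t=Y_{n-1}$ for $S_{n-1}\le t<S_n$. Thus $X$ changes states according to $\{Y_n\}$, and its sojourn times in a state $i\le p$ have density $f_i$. The matrix $\boldsymbol{\Lambda}=(\lambda_{ij})$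 is given by $\lambda_{ij}=\lambda_i q_{ij}$ for $i\ne j$ and $\lambda_{ii}=-\lambda_i=-\sum_{k\neq i}\lambda_{ik}$; its last row is zero, so it has the block form $\begin{pmatrix}\boldsymbol{T}&\boldsymbol{t}\\ \boldsymbol{0}&0\end{pmatrix}$ with $\boldsymbol{T}$ of size $p\times p$ and $\boldsymbol{t}=-\boldsymbol{T}\boldsymbol{e}$. Matrix Mittag-Leffler distribution: $\tau\sim\mathrm{MML}(\alpha,\boldsymbol{\pi},\boldsymbol{T})$ means that $\tau$ is a nonnegative random variable with Laplace transform $\mathbb{E}(e^{-u\tau})=\boldsymbol{\pi}(u^\alpha\boldsymbol{I}-\boldsymbol{T})^{-1}\boldsymbol{t}$, $u\ge0$. *)

(* Defs.v *)
From HB Require Import structures.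
From mathcomp Require Export all_boot all_order all_algebra finmap.
From mathcomp Require Export all_classical all_reals all_analysis.
(* Needed for the Borel structure of \bar R; not part of all_analysis. *)
From mathcomp Require Export measurable_realfun.
Export Order.TTheory GRing.Theory Num.Theory.
Export numFieldNormedType.Exports.

Set Implicit Arguments.
Unset Strict Implicit.
Unset Printing Implicit Defensive.

Local Open Scope classical_set_scope.
Local Open Scope ring_scope.

(* Only used for 0 < x, where the integral converges. *)
Definition Gamma {R : realType} (x : R) : R :=
  \int[lebesgue_measure]_(s in `]0, +oo[) (s `^ (x - 1) * expR (- s)).

Definition ML {R : realType} (a b z : R) : R :=
  limn (fun n => \sum_(0 <= k < n) z ^+ k / Gamma (a * k%:R + b)).

(* The limit is taken in the (entrywise) topology of matrices. *)
Definition ML_mx {R : realType} {p : nat} (a b : R) (A : 'M[R]_p) : 'M[R]_p :=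
  limn (fun n => \sum_(0 <= k < n) (Gamma (a * k%:R + b))^-1 *: A ^+ k
        : 'M[R]_p).

Definition ones {R : realType} (p : nat) : 'cV[R]_p := const_mx 1.

Definition ML_density {R : realType} (a l x : R) : R :=
  l * x `^ (a - 1) * ML a a (- l * x `^ a).

Definition has_ML_density {d} {Omega : measurableType d} {R : realType}
    (P : probability Omega R) (a l : R) (Z : {RV P >-> R}) : Prop :=
  forall B : set R, measurable B ->
    distribution P Z B =
    (\int[lebesgue_measure]_(x in B `&` `]0%R, +oo[) (ML_density a l x)%:E)%E.

(* The state space {1, ..., p, p+1} is 'I_(p + 1): lshift 1 i (i : 'I_p) are
   the states 1, ..., p and absorbing p is the state p+1. *)
Definition absorbing (p : nat) : 'I_(p + 1) := rshift p ord0.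

Definition stochastic {R : realType} {n : nat} (Q : 'M[R]_n) : Prop :=
  (forall i j, 0 <= Q i j) /\ (forall i, \sum_j Q i j = 1).

(* Probability, for a chain with transition matrix Q started in i, that the
   first visit to j at a time >= 1 takes place at time n + 1. *)
Fixpoint first_passage {R : realType} {m : nat} (Q : 'M[R]_m) (n : nat)
    (i j : 'I_m) : R :=
  if n is n'.+1 then \sum_(k | k != j) Q i k * first_passage Q n' k j
  else Q i j.

(* The chain started in i returns to i with probability < 1. *)
Definition transient {R : realType} {m : nat} (Q : 'M[R]_m) (i : 'I_m) : Prop :=
  (\sum_(0 <= n <oo) (first_passage Q n i i)%:E < 1)%E.

(* Markov property in product form:
   P(Y_0 = s_0, ..., Y_n+1 = s_n+1) = P(Y_0 = s_0, ..., Y_n = s_n) q_(s_n,s_n+1),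
   which carries no information when the conditioning event is null. *)
Definition markov_chain {d} {Omega : measurableType d} {R : realType}
    (P : probability Omega R) {m : nat} (Q : 'M[R]_m)
    (Y : nat -> Omega -> 'I_m) : Prop :=
  (forall n i, measurable (Y n @^-1` [set i])) /\
  (forall (n : nat) (s : nat -> 'I_m),
     P [set w | forall k, (k <= n.+1)%N -> Y k w = s k] =
     (P [set w | forall k, (k <= n)%N -> Y k w = s k]
        * (Q (s n) (s n.+1))%:E)%E).

Definition mutually_independent {d} {Omega : measurableType d} {R : realType}
    (P : probability Omega R) {I : choiceType} (F : I -> set (set Omega)) : Prop :=
  forall (J : {fset I}) (A : I -> set Omega),
    (forall j, j \in J -> F j (A j)) ->
    P (\bigcap_(j in [set` J]) A j) = (\prod_(j <- J) P (A j))%E.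

Definition sigma_RV {d} {Omega : measurableType d} {R : realType}
    (P : probability Omega R) (Z : {RV P >-> R}) : set (set Omega) :=
  preimage_set_system setT Z measurable.

Definition sigma_chain {Omega : Type} {m : nat} (Y : nat -> Omega -> 'I_m) :
    set (set Omega) :=
  <<s [set A | exists n (B : set 'I_m), A = Y n @^-1` B] >>.

(* The sigma-algebras generated by the single variables W i n, together with
   (index None) the one generated by the whole chain Y. *)
Definition sojourn_chain_sigma {d} {Omega : measurableType d} {R : realType}
    (P : probability Omega R) {p : nat} (W : 'I_p -> nat -> {RV P >-> R})
    (Y : nat -> Omega -> 'I_(p + 1)) (o : option ('I_p * nat)) :
    set (set Omega) :=
  if o is Some (i, n) then sigma_RV (W i n) else sigma_chain Y.

Definition ext_rate {R : realType} {p : nat} (lam : 'I_p -> R)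
    (i : 'I_(p + 1)) : R :=
  if fintype.split i is inl j then lam j else 0.

Definition intensity_matrix {R : realType} {p : nat} (lam : 'I_p -> R)
    (Q : 'M[R]_(p + 1)) : 'M[R]_(p + 1) :=
  \matrix_(i, j) if i == j then - ext_rate lam i else ext_rate lam i * Q i j.

Section semi_markov.
Context {Omega : Type} {R : realType} {p : nat}.
Variables (W : 'I_p -> nat -> Omega -> R) (Y : nat -> Omega -> 'I_(p + 1)).

(* Sojourn numbers start at 0: W i n and sojourn i n are T^i_(n+1). *)
Definition sojourn (i : 'I_(p + 1)) (n : nat) (w : Omega) : \bar R :=
  if fintype.split i is inl j then (W j n w)%:E else +oo%E.

Definition jump_time (n : nat) (w : Omega) : \bar R :=
  (\sum_(m < n) sojourn (Y m w) m w)%E.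

(* X_t = Y_n for S_n <= t < S_(n+1).  The value is None when there is no such n.
   The interval is unique as soon as the sojourn times are nonnegative; taking
   the first one only matters on the null event where some W i n is negative. *)
Definition semi_markov (t : R) (w : Omega) : option 'I_(p + 1) :=
  match pselect (exists n, (jump_time n w <= t%:E < jump_time n.+1 w)%E) with
  | left h => Some (Y (ex_minn h) w)
  | right _ => None
  end.

Definition absorption_time (w : Omega) : \bar R :=
  ereal_inf [set t%:E | t in [set t : R | 0 <= t /\
                                semi_markov t w = Some (absorbing p)]].

End semi_markov.

(* invmx is the identity on non-invertible matrices, so the existence of the
   inverse is part of the definition. The exit vector is t = - T e. *)
Definition is_MML {d} {Omega : measurableType d} {R : realType}
    (P : probability Omega R) {p : nat} (a : R) (pi : 'rV[R]_p) (T : 'M[R]_p)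
    (tau : Omega -> \bar R) : Prop :=
  [/\ measurable_fun setT tau,
      {ae P, forall w, (0 <= tau w < +oo)%E} &
      forall u : R, 0 <= u ->
        (u `^ a)%:M - T \in unitmx /\
        (\int[P]_w expeR (- (u%:E * tau w)) =
         ((pi *m invmx ((u `^ a)%:M - T) *m (- (T *m ones p))) 0 0)%:E)%E].

(* Main.v *)
(* Condition on the path of the chain up to absorption.  If the chain reaches
   the absorbing state at step k, then tau is the sum of the k sojourn times
   along the path, so independence factorizes E(e^(-u tau)) on that event into
   a product of Laplace transforms l / (u^alpha + l).  Summing over paths and k
   gives a matrix geometric series in A = diag(l / (u^alpha + l)) Q1, whose
   powers are dominated by those of Q1 and hence tend to 0 by transience; its
   sum is pi (u^alpha I - T)^(-1) t.  The Mittag-Leffler transform itself comes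
   from termwise integration only for u^alpha > l.  It extends to all u > 0
   because a Laplace transform of a positive measure is determined, through a
   series of finite differences with nonnegative terms, by its values far out
   (laplace_binomial_diff).  For the distribution function, P(tau <= x) and
   1 - pi E(T x^alpha) e have the same Laplace transform for large u; an explicit
   polynomial kernel in e^(-x) shows that their integrals over all intervals
   agree, and monotonicity of the first with continuity of the second give
   equality everywhere. *)
From HB Require Import structures.
Require Import Defs.
From mathcomp Require Import ring lra.

Set Implicit Arguments.
Unset Strict Implicit.
Unset Printing Implicit Defensive.

Local Open Scope classical_set_scope.
Local Open Scope ring_scope.

(** For u^alpha <= l the series of integrated absolute values diverges, so the Mittag-Leffler
    transform cannot be reached termwise there, and l / (u^alpha + l) is not known beforehand to be
    the transform of a positive measure at small u. The formula is therefore rephrased as phi + l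
    u^(-alpha) phi = l u^(-alpha), in which every term visibly is such a transform: u^(-alpha) comes
    from a power density, and the product from a sum of two coordinates on the plane. Sign is the
    obstacle for the distribution function too: 1 - pi E(T x^alpha) e is not known to be monotone,
    so two functions are compared instead of two measures. Almost sure absorption comes from the
    same matrix series, taken at u = 0: there every factor is 1 and (-T)^(-1) (-T e) = e, so the
    absorption probabilities sum to 1. *)

(** * Integrals against a weighted image measure *)

Section image_measure.
Local Open Scope ereal_scope.
Context d d' (S : measurableType d) (V : measurableType d') (R : realType).
Variables (m : {measure set S -> \bar R}) (mu : {measure set V -> \bar R}).
Variables (c : R) (X : S -> V) (g : S -> R).
Hypothesis mX : measurable_fun setT X.
Hypotheses (mg : measurable_fun setT g) (g0 : forall x, (0 <= g x)%R).
Hypothesis gX : forall B, measurable B -> \int[m]_(x in X @^-1` B) (g x)%:E = c%:E * mu B.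

Import HBNNSimple.

(** [gX] is the case of indicators; linearity gives simple functions, monotone convergence the rest.
    It is used with [X] the identity and [g] a density, and with [X] one sojourn time and [g] the
    product of the remaining factors of an expectation. *)
Lemma integral_image_measure (h : V -> \bar R) :
  measurable_fun setT h -> (forall y, 0 <= h y) ->
  \int[m]_x (h (X x) * (g x)%:E) = c%:E * \int[mu]_y h y.
Proof.
move=> mh h0; pose f_ := nnsfun_approx measurableT mh.
have mgE : measurable_fun setT (fun x => (g x)%:E) by exact/measurable_EFinP.
have f_cvg y : EFin \o f_^~ y @ \oo --> h y.
  exact: cvg_nnsfun_approx.
have f_nd y : nondecreasing_seq (fun n => (f_ n y)%:E).
  by move=> a b ab; rewrite lee_fin; exact/lefP/nd_nnsfun_approx.
have mXB B : measurable B -> measurable (X @^-1` B).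
  by move=> mB; rewrite -(setTI (_ @^-1` _)); exact: mX.
have simple n : \int[m]_x ((f_ n (X x))%:E * (g x)%:E) = c%:E * \int[mu]_y (f_ n y)%:E.
  transitivity (\sum_(r \in range (f_ n))
      \int[m]_x (r%:E * ((\1_(X @^-1` (f_ n @^-1` [set r])) x)%:E * (g x)%:E))).
    rewrite -ge0_integral_fsum//; last 2 first.
    - move=> r; apply: emeasurable_funM => //; apply: emeasurable_funM => //.
      by apply/measurable_EFinP; apply: measurable_indic; exact: mXB.
    - move=> r x _; rewrite -!EFinM lee_fin mulrA mulr_ge0//.
      exact: (nnfun_muleindic_ge0 (f_ n)).
    apply: eq_integral => x _; under eq_fsbigr do rewrite muleA.
    rewrite -ge0_mule_fsuml//; last first.
      by move=> r; rewrite -EFinM lee_fin; exact: (nnfun_muleindic_ge0 (f_ n)).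
    by rewrite fsumEFin// -fimfunE.
  rewrite integralT_nnsfun sintegralE ge0_mule_fsumr; last exact: nnsfun_mulemu_ge0.
  apply: eq_fsbigr => r rr.
  have r0 : (0 <= r)%R by move: rr; rewrite inE => -[y _ <-].
  rewrite ge0_integralZl//; last 2 first.
  - apply: emeasurable_funM => //.
    by apply/measurable_EFinP; apply: measurable_indic; exact: mXB.
  - by move=> x _; rewrite mule_ge0// lee_fin.
  rewrite muleCA; congr (_ * _); rewrite -gX//.
  rewrite [RHS]integral_mkcond; apply: eq_integral => x _.
  by rewrite epatch_indic muleC.
transitivity (limn (fun n => \int[m]_x ((f_ n (X x))%:E * (g x)%:E))).
  rewrite -monotone_convergence//.
  - apply: eq_integral => x _; apply/esym/cvg_lim => //.
    apply: cvgeZr => //; exact: f_cvg.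
  - move=> n; apply: emeasurable_funM => //; apply/measurable_EFinP.
    exact: measurableT_comp.
  - by move=> n x _; rewrite mule_ge0// lee_fin.
  - by move=> x _ a b ab; rewrite lee_wpmul2r ?lee_fin//; exact: f_nd.
under eq_fun do rewrite simple.
apply/cvg_lim => //; apply: cvgeZl => //.
rewrite [X in _ --> X](_ : _ = \int[mu]_y limn (fun n => (f_ n y)%:E)); last first.
  by apply: eq_integral => y _; apply/esym/cvg_lim => //; exact: f_cvg.
apply: cvg_monotone_convergence => //.
- by move=> n; apply/measurable_EFinP.
- by move=> n x _; rewrite lee_fin.
Qed.
End image_measure.

(** * Gamma integrals *)

Section half_line.
Context {R : realType}.
Local Notation mu := (@lebesgue_measure R).
Local Open Scope ereal_scope.

(** The right-hand side is a measure in [A], namely a scaled pushforward, and it agrees with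
    Lebesgue measure on half-open intervals. *)
Lemma lebesgue_measure_scale (u : R) (u0 : (0 < u)%R) (A : set R) :
  measurable A -> mu A = u%:E * mu [set x | A (u * x)%R].
Proof.
move=> mA.
have mF : measurable_fun setT (fun x : measurableTypeR R => (u * x)%R : measurableTypeR R).
  by apply: measurable_funM.
pose F (x : measurableTypeR R) : measurableTypeR R := (u * x)%R.
pose nu := mscale (NngNum (ltW u0)) (measure_function_pushforward__canonical__measure_function_Measure mu mF).
rewrite (@lebesgue_measure_unique _ nu)//.
move=> _ [[a b]] _ <-.
rewrite /nu/= /mscale/= /pushforward /=.
rewrite (_ : _ @^-1` _ = `](a / u)%R, (b / u)%R]%classic); last first.
  by apply/seteqP; split => x/=; rewrite !in_itv/= ltr_pdivrMr// ler_pdivlMr// ![(_ * u)%R]mulrC.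
rewrite !lebesgue_measure_itv/= !lte_fin ltr_pM2r ?invr_gt0//.
case: ifP => _; last by rewrite mule0.
by rewrite -!EFinD -EFinM -mulrBl mulrCA divff ?mulr1// gt_eqF.
Qed.

Lemma integral_half_line_scale (u : R) (u0 : (0 < u)%R) (f : R -> \bar R) :
  measurable_fun setT f -> (forall x, 0 <= f x) ->
  \int[mu]_(x in `]0%R, +oo[) f x = u%:E * \int[mu]_(x in `]0%R, +oo[) f (u * x)%R.
Proof.
move=> mf f0.
have mF : measurable_fun setT (fun x : measurableTypeR R => (u * x)%R : measurableTypeR R).
  by apply: measurable_funM.
pose F (x : measurableTypeR R) : measurableTypeR R := (u * x)%R.
pose nu := mscale (NngNum (ltW u0)) (measure_function_pushforward__canonical__measure_function_Measure mu mF).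
transitivity (\int[nu]_(x in `]0%R, +oo[) f x).
  by apply: eq_measure_integral => A mA _; exact: lebesgue_measure_scale.
rewrite ge0_integral_mscale//=; last exact: measurable_funTS.
congr (_ * _); rewrite ge0_integral_pushforward//; last exact: measurable_funTS.
congr (\int[mu]_(x in _) _).
by apply/seteqP; split => x/=; rewrite !in_itv/= !andbT pmulr_rgt0.
Qed.

Lemma integral_powR_unit (a : R) : (0 < a)%R ->
  \int[mu]_(x in `]0%R, 1%R]) (x `^ (a - 1))%:E <= (a^-1)%:E.
Proof.
(* The integrand may be singular at 0, hence the exhaustion by compact intervals; [n.+2] keeps each
   left end point strictly below 1. *)
move=> a0; pose F (n : nat) : set R := `[(n.+2%:R^-1)%R, 1%R]%classic.
have <- : \bigcup_n F n = `]0%R, 1%R]%classic.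
  apply/seteqP; split => [x [n _]|x]; rewrite /F/= !in_itv/=.
    by move=> /andP[h ->]; rewrite (lt_le_trans _ h)// invr_gt0.
  move=> /andP[x0 x1]; exists (Num.truncn x^-1) => //=; rewrite in_itv/= x1 andbT.
  rewrite invf_ple ?posrE//; apply: ltW.
  have := Num.Theory.truncnS_gt x^-1; move/lt_trans; apply; rewrite ltr_nat//.
have FE n : \int[mu]_(x in F n) (x `^ (a - 1))%:E <= (a^-1)%:E.
  have n0 : (0 < n.+2%:R^-1 :> R)%R by rewrite invr_gt0.
  have n1 : (n.+2%:R^-1 < 1 :> R)%R by rewrite invf_lt1// ltr1n.
  rewrite (@continuous_FTC2 _ _ (fun x => a^-1 * x `^ a)%R)//.
  - rewrite powR1 mulr1 -EFinB lee_fin lerBlDr lerDl mulr_ge0 ?powR_ge0//.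
    by rewrite invr_ge0 ltW.
  - apply: derivable_within_continuous => x; rewrite in_itv/= => /andP[h _].
    by apply: derivable_powR; rewrite in_itv/= andbT (lt_le_trans n0).
  - have dF x : (0 < x)%R -> derivable (fun x => a^-1 * x `^ a)%R x 1.
      move=> x0; apply: derivableM => //.
      by apply: derivable_powR; rewrite in_itv/= andbT.
    have cF x : (0 < x)%R -> {for x, continuous (fun x => a^-1 * x `^ a)%R}.
      by move=> /dF/derivable1_diffP/differentiable_continuous.
    split.
    + by move=> x; rewrite in_itv/= => /andP[h _]; apply: dF; rewrite (lt_trans n0).
    + by apply: cvg_at_right_filter; exact: cF.
    + by apply: cvg_at_left_filter; apply: cF.
  - move=> x; rewrite in_itv/= => /andP[h _].
    have x0 := lt_trans n0 h.
    rewrite derive1Ml; last by apply: derivable_powR; rewrite in_itv/= andbT.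
    by rewrite powR_derive1 ?in_itv/= ?x0// mulrA mulVf ?mul1r// gt_eqF.
apply: cvge_le; last first.
  apply: ge0_nondecreasing_set_cvg_integral => //.
  - move=> n m nm; rewrite subsetEset => x; rewrite /F/= !in_itv/= => /andP[h ->].
    by rewrite andbT (le_trans _ h)// lef_pV2 ?posrE// ler_nat.
  - by move=> n; apply: measurable_itv.
  - by move=> n; apply/measurable_EFinP; apply: measurable_funTS; exact: measurable_powR.
  - by move=> n x _; rewrite lee_fin powR_ge0.
by apply: nearW => n; exact: FE.
exact: eventually_filter.
Qed.

Lemma integral_half_line_expRN (u : R) : (0 < u)%R ->
  \int[mu]_(x in `]0%R, +oo[) (expR (- (u * x)))%:E = (u^-1)%:E.
Proof.
move=> u0.
have mE : measurable_fun setT (fun x : R => (expR (- (u * x)))%:E).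
  apply/measurable_EFinP; apply: measurableT_comp => //.
  by apply: measurableT_comp => //; exact: measurable_funM.
have := integral_exponential_pdf u0.
rewrite [X in X = _ -> _](_ : _ = u%:E * \int[mu]_(x in `]0%R, +oo[) (expR (- (u * x)))%:E).
  move=> /(congr1 (fun z => (u^-1)%:E * z)); rewrite muleA -EFinM mulVf ?gt_eqF//.
  by rewrite mul1e mule1.
rewrite -ge0_integralZl//; last 2 first.
- exact: measurable_funTS.
- by rewrite lee_fin ltW.
rewrite integral_itv_obnd_cbnd; last first.
  by apply: measurable_funTS; exact: emeasurable_funM.
rewrite [RHS]integral_mkcond; apply: eq_integral => x _.
rewrite /exponential_pdf /patch/=.
by case: ifPn => //; rewrite mulNr EFinM.
Qed.

Lemma measurable_powR_expR (b u : R) :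
  measurable_fun setT (fun x : R => (x `^ b * expR (- (u * x)))%:E).
Proof.
apply/measurable_EFinP; apply: measurable_funM; first exact: measurable_powR.
apply: measurableT_comp => //; exact: measurableT_comp.
Qed.

(** One term of the exponential series at x / 2, of degree N > |a|, dominates the power, whence the
    constant 2^N N!. Half of the decay of exp(-x) remains to make the tail of the Gamma integral
    converge. *)
Lemma Gamma_bound (a : R) : exists2 C : R, (0 <= C)%R &
  forall x, (1 <= x)%R -> (x `^ (a - 1) <= C * expR (2^-1 * x))%R.
Proof.
pose n := Num.truncn `|a|%R.
exists (2 ^+ n.+1 * n.+1`!%:R)%R; first by rewrite mulr_ge0// exprn_ge0.
move=> x x1.
have x0 : (0 <= x)%R by exact: le_trans x1.
apply: (@le_trans _ _ (x `^ n.+1%:R)%R).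
  apply: ler_powR => //; rewrite lerBlDr (le_trans (ler_norm a))//.
  by rewrite (le_trans (ltW (truncnS_gt _)))// lerDl.
rewrite powR_mulrn// -[leLHS](_ : (2 ^+ n.+1 * (2^-1 * x) ^+ n.+1 = _)%R); last first.
  by rewrite -exprMn mulrA divff// mul1r.
rewrite -mulrA ler_wpM2l ?exprn_ge0//.
rewrite [leRHS]mulrC -ler_pdivrMr ?ltr0n ?fact_gt0//.
by rewrite (le_trans _ (expR_ge1Dxn n _))// ?lerDr// mulr_ge0// invr_ge0.
Qed.

Lemma gamma_integral_lty (a : R) : (0 < a)%R ->
  \int[mu]_(s in `]0%R, +oo[) (s `^ (a - 1) * expR (- s))%:E < +oo.
Proof.
move=> a0.
have mg : measurable_fun setT (fun s : R => (s `^ (a - 1) * expR (- s))%:E).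
  by under eq_fun do rewrite -[X in expR (- X)]mul1r; exact: measurable_powR_expR.
have g0 (s : R) : 0 <= (s `^ (a - 1) * expR (- s))%:E.
  by rewrite lee_fin mulr_ge0 ?powR_ge0 ?expR_ge0.
have -> : `]0%R, +oo[%classic = `]0%R, 1%R]%classic `|` `]1%R, +oo[%classic :> set R.
  apply/seteqP; split => x /=; rewrite !in_itv/= ?andbT.
    by move=> ->/=; case: (leP x 1%R) => h; [left|right].
  by case=> [/andP[]//|]; exact: lt_trans.
rewrite ge0_integral_setU//; last 2 first.
- exact: measurable_funTS.
- apply/disj_setPS => x [] /=; rewrite !in_itv/= => /andP[_ x1]; rewrite andbT.
  by rewrite ltNge x1.
apply: lte_add_pinfty.
  apply: (@le_lt_trans _ _ (\int[mu]_(s in `]0%R, 1%R]) (s `^ (a - 1))%:E)).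
    apply: ge0_le_integral => //.
    - exact: measurable_funTS.
    - by apply/measurable_EFinP; apply: measurable_funTS; exact: measurable_powR.
    - move=> x; rewrite /= in_itv/= => /andP[x0 _].
      by rewrite lee_fin ler_piMr ?powR_ge0// -expR0 ler_expR oppr_le0 ltW.
  by rewrite (le_lt_trans (integral_powR_unit a0))// ltry.
have mE : measurable_fun setT (fun s : R => (expR (- (2^-1 * s)))%:E).
  by apply/measurable_EFinP; apply: measurableT_comp => //; exact: measurableT_comp.
have [C C0 HC] := Gamma_bound a.
apply: (@le_lt_trans _ _ (\int[mu]_(s in `]0%R, +oo[) (C%:E * (expR (- (2^-1 * s)))%:E))); last first.
  rewrite ge0_integralZl// ?integral_half_line_expRN//.
  - by rewrite -EFinM ltry.
  - exact: measurable_funTS.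
apply: (@le_trans _ _ (\int[mu]_(s in `]1%R, +oo[) (C%:E * (expR (- (2^-1 * s)))%:E))).
  apply: ge0_le_integral => //.
  - exact: measurable_funTS.
  - apply: emeasurable_funM => //.
    exact: measurable_funTS.
  - move=> x; rewrite /= in_itv/= andbT => /ltW x1.
    rewrite -EFinM lee_fin.
    have H := HC _ x1; rewrite -(ler_pM2r (expR_gt0 (- x))) in H.
    apply: (le_trans H).
    rewrite -mulrA -expRD.
    by rewrite ler_wpM2l// ler_expR; lra.
apply: ge0_subset_integral => //.
- apply: emeasurable_funM => //.
  exact: measurable_funTS.
- by move=> x _; rewrite -EFinM lee_fin mulr_ge0// expR_ge0.
- by move=> x/=; rewrite !in_itv/= !andbT; exact: lt_trans.
Qed.
End half_line.

Section Gamma_facts.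
Context {R : realType}.
Local Notation mu := (@lebesgue_measure R).
Local Open Scope ereal_scope.

Lemma integral_Gamma (a : R) : (0 < a)%R ->
  \int[mu]_(s in `]0%R, +oo[) (s `^ (a - 1) * expR (- s))%:E = (Gamma a)%:E.
Proof.
move=> a0; rewrite /Gamma /Rintegral fineK// ge0_fin_numE ?gamma_integral_lty//.
by apply: integral_ge0 => s _; rewrite lee_fin mulr_ge0 ?powR_ge0 ?expR_ge0.
Qed.

(** The integral is restricted to [M, M + 1], where the integrand is bounded below by a constant.
    Since [M] is free, this makes [Gamma (a * k%:R + b)] grow faster than any geometric sequence in
    k. *)
Lemma Gamma_ge (a M : R) : (0 < a)%R -> (1 <= M)%R ->
  (M `^ a * (expR (- (M + 1)) / (M + 1)) <= Gamma a)%R.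
Proof.
move=> a0 M1; rewrite -lee_fin -integral_Gamma//.
have M0 : (0 < M)%R by exact: lt_le_trans M1.
have mg : measurable_fun setT (fun s : R => (s `^ (a - 1) * expR (- s))%:E).
  by under eq_fun do rewrite -[X in expR (- X)]mul1r; exact: measurable_powR_expR.
have g0 (s : R) : 0 <= (s `^ (a - 1) * expR (- s))%:E.
  by rewrite lee_fin mulr_ge0 ?powR_ge0 ?expR_ge0.
apply: (@le_trans _ _ (\int[mu]_(s in `[M, (M + 1)%R]) (s `^ (a - 1) * expR (- s))%:E)); last first.
  apply: ge0_subset_integral => //; first exact: measurable_funTS.
  by move=> x/=; rewrite !in_itv/= andbT => /andP[+ _]; exact: lt_le_trans.
set c := (_ * _)%R.
have -> : c%:E = \int[mu]_(s in `[M, (M + 1)%R]) (cst c%:E s).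
  rewrite integral_cst//= lebesgue_measure_itv/= lte_fin ltrDl ltr01.
  by rewrite -EFinB addrAC subrr add0r mule1.
have key (x : R) : (M <= x)%R -> (x <= M + 1)%R -> (c <= x `^ (a - 1) * expR (- x))%R.
  move=> Mx xM; have x0 : (0 < x)%R by exact: lt_le_trans Mx.
  rewrite /c powRB; last by rewrite (gt_eqF x0) implybT.
  rewrite powRr1 ?(ltW x0)// -[leRHS]mulrA ler_pM ?powR_ge0//.
  - by rewrite divr_ge0 ?expR_ge0// addr_ge0// ltW.
  - by apply: ge0_ler_powR => //; rewrite ?nnegrE ltW.
  - rewrite mulrC ler_pM ?expR_ge0 ?invr_ge0 ?addr_ge0 ?(ltW M0)//.
    + by rewrite lef_pV2 ?posrE// addr_gt0.
    + by rewrite ler_expR lerN2.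
apply: ge0_le_integral => //.
- move=> x _; rewrite lee_fin /c mulr_ge0 ?powR_ge0// divr_ge0 ?expR_ge0//.
  by rewrite addr_ge0// ltW.
- exact: measurable_funTS.
by move=> x; rewrite /= in_itv/= => /andP[Mx xM]; rewrite lee_fin key.
Qed.

Lemma Gamma_gt0 (a : R) : (0 < a)%R -> (0 < Gamma a)%R.
Proof.
move=> a0; apply: lt_le_trans (Gamma_ge a0 (lexx 1%R)).
by rewrite mulr_gt0 ?powR_gt0// divr_gt0 ?expR_gt0.
Qed.

Lemma Gamma1 : Gamma 1 = 1%R :> R.
Proof.
apply: EFin_inj; rewrite -integral_Gamma//.
have := @integral_half_line_expRN R 1 ltr01; rewrite invr1 => <-.
by apply: eq_integral => s _; rewrite subrr powRr0 !mul1r.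
Qed.

Lemma laplace_powR (a u : R) : (0 < a)%R -> (0 < u)%R ->
  \int[mu]_(x in `]0%R, +oo[) (x `^ (a - 1) * expR (- (u * x)))%:E =
  (Gamma a * u `^ (- a))%:E.
Proof.
move=> a0 u0; have g0 (v x : R) : (0 <= x `^ (a - 1) * expR (- (v * x)))%R.
  by rewrite mulr_ge0 ?powR_ge0 ?expR_ge0.
have := integral_Gamma a0.
have -> : \int[mu]_(s in `]0%R, +oo[) (s `^ (a - 1) * expR (- s))%:E =
    \int[mu]_(s in `]0%R, +oo[) (s `^ (a - 1) * expR (- (1 * s)))%:E.
  by under [RHS]eq_integral do rewrite mul1r.
rewrite (integral_half_line_scale u0); last 2 first.
  exact: measurable_powR_expR.
  by move=> x; rewrite lee_fin.
rewrite (_ : \int[mu]_(x in _) _ = (u `^ (a - 1))%:E *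
   \int[mu]_(x in `]0%R, +oo[) (x `^ (a - 1) * expR (- (u * x)))%:E).
  move=> h; rewrite EFinM -h muleA -muleA muleAC muleA -!EFinM.
  rewrite -[X in (X * _ * _)%R](powRr1 (ltW u0)).
  rewrite -!powRD ?(gt_eqF u0) ?implybT//.
  by rewrite (_ : 1 + - a + (a - 1) = 0)%R ?powRr0 ?mul1e//; ring.
rewrite -ge0_integralZl//; last 3 first.
- by apply: measurable_funTS; exact: measurable_powR_expR.
- by move=> x _; rewrite lee_fin.
- by rewrite lee_fin powR_ge0.
apply: eq_integral => x; rewrite inE/= in_itv/= andbT => x0.
by rewrite -EFinM powRM ?ltW// mul1r mulrA.
Qed.
End Gamma_facts.

(** * Laplace transforms of Mittag-Leffler series *)

Section ML_series.
Context {R : realType} (a b C K : R) (c : nat -> R).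
Hypotheses (a0 : 0 < a) (b0 : 0 < b) (K0 : 0 < K).
Hypothesis cK : forall k, `|c k| <= C * K ^+ k.
Local Notation mu := (@lebesgue_measure R).

Let e0 k : 0 < a * k%:R + b. Proof. by rewrite ltr_wpDl// mulr_ge0// ltW. Qed.
Let C0 : 0 <= C.
Proof. by have := cK 0; rewrite expr0 mulr1; apply: le_trans. Qed.

Lemma ML_coef_bound (z : R) : 0 <= z ->
  exists2 D, 0 <= D & forall k, `|c k| / Gamma (a * k%:R + b) * z ^+ k <= D * 2^-1 ^+ k.
Proof.
(* This [M] satisfies M^a >= 2 K z, so the bound (M^a)^k on the Gamma factor leaves the ratio K z /
   M^a <= 1/2. *)
move=> z0; pose M := Num.max 1 ((2 * K * z) `^ a^-1).
have M1 : 1 <= M by rewrite le_max lexx.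
have M0 : 0 < M by exact: lt_le_trans M1.
have Ma : 2 * K * z <= M `^ a.
  have y0 : 0 <= 2 * K * z by rewrite !mulr_ge0// ltW.
  rewrite -[leLHS](powRr1 y0) -[X in _ `^ X](@mulVf _ a) ?gt_eqF//.
  by rewrite powRrM ge0_ler_powR ?nnegrE ?powR_ge0 ?(ltW a0) ?(ltW M0)// le_max lexx orbT.
pose g := M `^ b * (expR (- (M + 1)) / (M + 1)).
have g0 : 0 < g by rewrite /g mulr_gt0 ?powR_gt0 ?divr_gt0 ?expR_gt0 ?addr_gt0.
exists (C / g); first by rewrite divr_ge0// ltW.
move=> k; have Gk : (M `^ a) ^+ k * g <= Gamma (a * k%:R + b).
  apply: le_trans (Gamma_ge (e0 k) M1); rewrite /g mulrA ler_wpM2r//.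
    by rewrite divr_ge0 ?expR_ge0// addr_ge0// ltW.
  by rewrite powRD ?(gt_eqF M0) ?implybT// powRrM powR_mulrn ?powR_ge0.
rewrite mulrAC ler_pdivrMr ?(Gamma_gt0 (e0 k))//.
apply: le_trans (ler_wpM2l _ Gk); last first.
  by rewrite mulr_ge0 ?exprn_ge0// divr_ge0// ltW.
rewrite [leRHS](_ : _ = C * (2^-1 * M `^ a) ^+ k); last first.
  by rewrite exprMn; field; rewrite gt_eqF.
apply: (@le_trans _ _ (C * K ^+ k * z ^+ k)); first by rewrite ler_wpM2r ?exprn_ge0.
rewrite -mulrA ler_wpM2l// -exprMn lerXn2r ?nnegrE ?mulr_ge0 ?powR_ge0 ?(ltW K0)//.
by rewrite ler_pdivlMl// mulrA.
Qed.

Lemma ML_series_cvg (z : R) : 0 <= z ->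
  cvgn (series (fun k => c k / Gamma (a * k%:R + b) * z ^+ k)).
Proof.
move=> z0; have [D D0 HD] := ML_coef_bound z0.
apply: normed_cvg; apply: (@series_le_cvg _ _ (geometric D 2^-1)).
- by move=> n /=.
- by move=> n /=; rewrite mulr_ge0// exprn_ge0.
- move=> n; rewrite /= normrM normrM normfV (gtr0_norm (Gamma_gt0 (e0 n))).
  by rewrite (ger0_norm (exprn_ge0 _ z0)).
- by apply: is_cvg_geometric_series; rewrite ger0_norm// invf_lt1// ltr1n.
Qed.

Section laplace.
Variables (f : R -> R) (u : R).
Hypotheses (u0 : 0 < u) (Ku : K < u `^ a).
Let t (k : nat) (x : R) : R := c k * (x `^ (a * k%:R + b - 1) / Gamma (a * k%:R + b)).
Hypothesis tf : forall x : R, 0 < x -> series (t ^~ x) @ \oo --> f x.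

Local Open Scope ereal_scope.

Let h (k : nat) (x : R) : \bar R := (x `^ (a * k%:R + b - 1) * expR (- (u * x)))%:E.
Let mh k : measurable_fun setT (h k).
Proof. exact: measurable_powR_expR. Qed.
Let h0 k x : 0 <= h k x.
Proof. by rewrite lee_fin mulr_ge0 ?powR_ge0 ?expR_ge0. Qed.
Let ih k : mu.-integrable `]0%R, +oo[ (h k).
Proof.
apply/integrableP; split; first by apply: measurable_funTS; exact: mh.
under eq_integral do rewrite gee0_abs//.
by rewrite laplace_powR ?e0// ltry.
Qed.

Let g (x : R) : \bar R := \sum_(0 <= k <oo) ((`|c k| / Gamma (a * k%:R + b))%:E * h k x).
Let g0 k x : 0 <= (`|c k| / Gamma (a * k%:R + b))%:E * h k x.
Proof. by rewrite mule_ge0// lee_fin divr_ge0// ltW// Gamma_gt0. Qed.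

Let ig : mu.-integrable `]0%R, +oo[ g.
Proof.
have mg : measurable_fun (`]0%R, +oo[%classic : set R) g.
  apply: ge0_emeasurable_sum => // k _.
  by apply: emeasurable_funM => //; by apply: measurable_funTS; exact: mh.
apply/integrableP; split => //.
under eq_integral do rewrite gee0_abs ?nneseries_ge0//.
rewrite integral_nneseries//; last first.
  by move=> k; apply: emeasurable_funM => //; by apply: measurable_funTS; exact: mh.
pose q := (K * (u `^ a)^-1)%R.
have q0 : (0 < q)%R by rewrite mulr_gt0// invr_gt0 powR_gt0.
have q1 : (q < 1)%R by rewrite /q ltr_pdivrMr ?powR_gt0// mul1r.
have nq1 : (`|q| < 1)%R by rewrite gtr0_norm.
pose D := (C * u `^ (- b))%R.
apply: (@le_lt_trans _ _ (D * (1 - q)^-1)%:E); last exact: ltry.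
apply: lime_le; first by apply: is_cvg_nneseries => k _ _; exact: integral_ge0.
apply: nearW => n; apply: (@le_trans _ _ (series (geometric D q) n)%:E); last first.
  by rewrite lee_fin geometric_le_lim// mulr_ge0 ?powR_ge0.
rewrite /series/= -sumEFin; apply: lee_sum => k _.
rewrite ge0_integralZl//; last 2 first.
- by apply: measurable_funTS; exact: mh.
- by rewrite lee_fin divr_ge0// ltW// Gamma_gt0.
rewrite laplace_powR ?e0// -EFinM lee_fin mulrA divfK ?gt_eqF ?Gamma_gt0//.
have -> : (u `^ (- (a * k%:R + b)) = (u `^ a)^-1 ^+ k * u `^ (- b))%R.
  by rewrite opprD powRD ?(gt_eqF u0) ?implybT// -mulNr powRrM powR_mulrn ?powR_ge0// (powRN u a).
rewrite [leRHS](_ : _ = C * K ^+ k * ((u `^ a)^-1 ^+ k * u `^ (- b)))%R; last first.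
  by rewrite /D /q exprMn; ring.
by rewrite ler_wpM2r// mulr_ge0 ?powR_ge0// exprn_ge0// invr_ge0 powR_ge0.
Qed.

(** Dominated convergence, with dominating function [g] the series of absolute values. The k-th term
    of [g] integrates to |c k| u^(-(a k + b)), which is at most geometric of ratio K / u^a; this is
    where [Ku] enters. The case b = a serves the density and b = 1 the distribution function. *)
Lemma laplace_ML_series :
  mu.-integrable `]0%R, +oo[ (fun x => (f x * expR (- (u * x)))%:E) /\
  (\sum_(0 <= k < n) c k * u `^ (- (a * k%:R + b)))%R%:E @[n --> \oo] -->
    \int[mu]_(x in `]0%R, +oo[) (f x * expR (- (u * x)))%:E.
Proof.
pose F (n : nat) (x : R) : \bar R := ((series (t ^~ x) n) * expR (- (u * x)))%:E.
have Fh n x : F n x =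
    \sum_(0 <= k < n) ((c k / Gamma (a * k%:R + b))%:E * h k x).
  rewrite /F /series/= big_distrl/= -sumEFin; apply: eq_bigr => k _.
  by rewrite -EFinM; congr EFin; rewrite /t; ring.
have mF n : measurable_fun (`]0%R, +oo[%classic : set R) (F n).
  apply: (eq_measurable_fun (fun x => \sum_(0 <= k < n) ((c k / Gamma (a * k%:R + b))%:E * h k x))).
    by move=> x _; rewrite -Fh.
  apply: emeasurable_sum => k; apply: emeasurable_funM => //.
  by apply: measurable_funTS; exact: mh.
have Ff x : `]0%R, +oo[%classic x -> F ^~ x @ \oo --> (f x * expR (- (u * x)))%:E.
  rewrite /= in_itv/= andbT => x0.
  apply: cvg_EFin; first exact: nearW.
  by apply: cvgMl; exact: tf.
have mf : measurable_fun (`]0%R, +oo[%classic : set R) (fun x => (f x * expR (- (u * x)))%:E).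
  exact: emeasurable_fun_cvg Ff.
have Fg x n : `|F n x| <= g x.
  rewrite Fh; apply: (@le_trans _ _ (\sum_(0 <= k < n)
      ((`|c k| / Gamma (a * k%:R + b))%:E * h k x))); last first.
    exact: nneseries_lim_ge.
  apply: le_trans (lee_abs_sum _ _ _) _; apply: lee_sum => k _.
  rewrite abseM (gee0_abs (h0 k x)) lee_wpmul2r// lee_fin normrM normfV.
  by rewrite (gtr0_norm (Gamma_gt0 (e0 k))).
have [] := @dominated_convergence _ _ _ mu `]0%R, +oo[%classic (measurable_itv _) F
  (fun x => (f x * expR (- (u * x)))%:E) g.
- exact: mF.
- exact: mf.
- by apply: aeW; exact: Ff.
- exact: ig.
- by apply: aeW => x n _; exact: Fg.
move=> i1 _ i3.
split => //; rewrite (_ : (fun n => _) = (fun n => \int[mu]_(x in `]0%R, +oo[) F n x))//.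
apply/funext => n; apply/esym.
under eq_integral do rewrite Fh.
rewrite integral_sum//; last by move=> k; apply: integrableZl => //; exact: ih.
rewrite -sumEFin; apply: eq_bigr => k _; rewrite (integralZl _ (ih k))//.
by rewrite laplace_powR ?e0// -EFinM mulrA divfK ?gt_eqF ?Gamma_gt0.
Qed.
End laplace.
End ML_series.

(** * Laplace transforms recovered from finite differences *)

(** Up to the sign (-1)^k, the k-th forward difference of [F] at u + e with step [e]. For the
    transform of a positive measure it is the integral of exp(-(u + e) X) (1 - exp(-e X))^k. *)
Definition binomial_diff {R : realType} (e : R) (F : R -> R) (u : R) (k : nat) : R :=
  \sum_(j < k.+1) (-1) ^+ j * 'C(k, j)%:R * F (u + e + e *+ j).

Section laplace_geometric.
Context d (S : measurableType d) (R : realType) (m : {measure set S -> \bar R}).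
Variables (X w : S -> R).
Hypotheses (mX : measurable_fun setT X) (mw : measurable_fun setT w).
Hypotheses (w0 : forall x, 0 <= w x) (X0 : forall x, w x != 0 -> 0 <= X x).
Variables (F : R -> R) (u e : R).
Hypothesis e0 : 0 < e.
Hypothesis mF : forall v : R, u + e <= v ->
  (\int[m]_x (w x * expR (- (v * X x)))%:E = (F v)%:E)%E.

Let mwE v : measurable_fun setT (fun x => (w x * expR (- (v * X x)))%:E).
Proof.
apply/measurable_EFinP; apply: measurable_funM => //.
by apply: measurableT_comp => //; apply: measurableT_comp => //; exact: measurable_funM.
Qed.

Let h k x : R := w x * expR (- ((u + e) * X x)) * (1 - expR (- (e * X x))) ^+ k.

Let h0 k x : 0 <= h k x.
Proof.
rewrite /h; have [->|wx] := eqVneq (w x) 0; first by rewrite !mul0r.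
rewrite mulr_ge0 ?mulr_ge0 ?expR_ge0// exprn_ge0// subr_ge0 -expR0 ler_expR.
by rewrite oppr_le0 mulr_ge0 ?X0// ltW.
Qed.

Let hE k x : h k x =
  \sum_(j < k.+1) (-1) ^+ j * 'C(k, j)%:R * (w x * expR (- ((u + e + e *+ j) * X x))).
Proof.
rewrite /h exprBn big_distrr/=; apply: eq_bigr => j _.
rewrite expr1n mulr1 -expRM_natl -mulrnAr.
have -> : - ((u + e + e *+ j) * X x) = - ((u + e) * X x) + j%:R * - (e * X x).
  by rewrite -mulr_natl; ring.
by rewrite expRD -[X in _ = X]mulr1 -mulr_natl; ring.
Qed.

Let h_int k : (\int[m]_x (h k x)%:E = (binomial_diff e F u k)%:E)%E.
Proof.
have i (j : nat) : m.-integrable setT (fun x => (w x * expR (- ((u + e + e *+ j) * X x)))%:E).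
  apply/integrableP; split => //.
  under eq_integral do rewrite gee0_abs ?lee_fin ?mulr_ge0 ?expR_ge0//.
  by rewrite mF ?ltry// lerDl mulrn_wge0// ltW.
under eq_integral do rewrite hE -sumEFin.
rewrite integral_sum//; last first.
  move=> j; under [X in _.-integrable _ X]eq_fun do rewrite EFinM.
  by apply: integrableZl => //; exact: i.
rewrite /binomial_diff -sumEFin; apply: eq_bigr => j _.
under eq_integral do rewrite EFinM.
by rewrite integralZl// mF ?EFinM// lerDl mulrn_wge0// ltW.
Qed.

Let mh k : measurable_fun setT (fun x => (h k x)%:E).
Proof.
apply/measurable_EFinP; apply: measurable_funM.
  by have /measurable_EFinP := mwE (u + e).
apply: measurable_funX; apply: measurable_funB => //.
by apply: measurableT_comp => //; apply: measurableT_comp => //; exact: measurable_funM.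
Qed.

(** This sign allows the difference series of two transforms to be added term by term in the
    extended reals. *)
Lemma binomial_diff_ge0 k : 0 <= binomial_diff e F u k.
Proof. by rewrite -lee_fin -h_int; apply: integral_ge0 => x _; rewrite lee_fin. Qed.

(* exp (e * X) is the sum of the geometric series in 1 - exp (- (e * X)), so the
   transform at u is determined by its values on [u + e, +oo[. *)
Lemma laplace_binomial_diff :
  (\int[m]_x (w x * expR (- (u * X x)))%:E =
   \sum_(0 <= k <oo) (binomial_diff e F u k)%:E)%E.
Proof.
transitivity (\sum_(0 <= k <oo) \int[m]_x (h k x)%:E)%E; last first.
  by apply: eq_eseriesr => k _; rewrite h_int.
rewrite -integral_nneseries//; last by move=> k x _; rewrite lee_fin.
apply: eq_integral => x _; apply/esym/cvg_lim => //.
apply: cvg_EFin; first by apply: nearW => n; rewrite sumEFin.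
rewrite (_ : _ \o _ = series (fun k => h k x)); last first.
  by apply/funext => n; rewrite /= sumEFin.
have [wx|wx] := eqVneq (w x) 0.
  rewrite wx mul0r (_ : series _ = cst 0); first exact: cvg_cst.
  by apply/funext => n; rewrite /series/= big1// => k _; rewrite /h wx !mul0r.
have Xx := X0 wx.
have E1 : `|1 - expR (- (e * X x))| < 1.
  have E0 := expR_gt0 (- (e * X x)).
  have : expR (- (e * X x)) <= 1 by rewrite -expR0 ler_expR oppr_le0 mulr_ge0// ltW.
  by rewrite ltr_norml; lra.
have := @cvg_geometric_series R (w x * expR (- ((u + e) * X x))) _ E1.
rewrite subKr.
have -> : w x * expR (- ((u + e) * X x)) / expR (- (e * X x)) = w x * expR (- (u * X x)).
  by rewrite -expRN opprK -mulrA -expRD; congr (_ * expR _); ring.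
exact.
Qed.
End laplace_geometric.

(** * The Mittag-Leffler law *)

Section ML_law.
Context {R : realType} (a l : R).
Hypotheses (a0 : 0 < a) (l0 : 0 < l).
Local Notation mu := (@lebesgue_measure R).
Local Notation f := (ML_density a l).

Let c (k : nat) : R := l * (- l) ^+ k.
Let cl k : `|c k| <= l * l ^+ k.
Proof. by rewrite /c normrM normrX normrN !gtr0_norm. Qed.

Lemma ML_density_series (x : R) : 0 < x ->
  series (fun k => c k * (x `^ (a * k%:R + a - 1) / Gamma (a * k%:R + a))) @ \oo --> f x.
Proof.
move=> x0.
have H : cvgn (series (fun k => (- l) ^+ k / Gamma (a * k%:R + a) * (x `^ a) ^+ k)).
  apply: (@ML_series_cvg R a a 1 l (fun k => (- l) ^+ k)) => //; last exact: powR_ge0.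
  by move=> k; rewrite normrX normrN gtr0_norm// mul1r.
have -> : f x = l * x `^ (a - 1) * limn (series (fun k => (- l) ^+ k / Gamma (a * k%:R + a) * (x `^ a) ^+ k)).
  rewrite /ML_density /ML (_ : (fun n => _) = series (fun k =>
      (- l) ^+ k / Gamma (a * k%:R + a) * (x `^ a) ^+ k))//.
  apply/funext => n; rewrite /series/=.
  by apply: eq_bigr => k _; rewrite exprMn; ring.
rewrite (_ : series _ = fun n => l * x `^ (a - 1) *
   series (fun k => (- l) ^+ k / Gamma (a * k%:R + a) * (x `^ a) ^+ k) n).
  by apply: cvgMr; exact: H.
apply/funext => n; rewrite /series/= big_distrr/=; apply: eq_bigr => k _.
rewrite -addrA (@powRD _ x (a * k%:R) (a - 1)) ?(gt_eqF x0) ?implybT// powRrM powR_mulrn ?powR_ge0//.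
by rewrite /c; ring.
Qed.

Let laplace_f (u : R) : 0 < u -> l < u `^ a ->
  mu.-integrable `]0%R, +oo[ (fun x => (f x * expR (- (u * x)))%:E) /\
  (\int[mu]_(x in `]0%R, +oo[) (f x * expR (- (u * x)))%:E = (l / (u `^ a + l))%:E)%E.
Proof.
move=> u0 lu; have ua : 0 < u `^ a by exact: lt_trans lu.
have [i H] := @laplace_ML_series R a a l l c a0 a0 l0 cl f u u0 lu ML_density_series.
split=> //; apply/esym; apply: cvg_unique H => //.
apply: cvg_EFin; first exact: nearW.
have q1 : `|- l / u `^ a| < 1.
  by rewrite normrM normrN normfV !gtr0_norm// ltr_pdivrMr// mul1r.
have := @cvg_geometric_series R (l * u `^ (- a)) _ q1.
rewrite (_ : l * u `^ (- a) / (1 - - l / u `^ a) = l / (u `^ a + l)); last first.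
  by rewrite powRN; field; rewrite !gt_eqF// addr_gt0.
rewrite (_ : series _ = (fun n => \sum_(0 <= k < n) c k * u `^ (- (a * k%:R + a))))//.
apply/funext => n; apply: eq_bigr => k _ /=.
rewrite opprD powRD ?(gt_eqF u0) ?implybT// -mulNr powRrM powR_mulrn ?powR_ge0//.
by rewrite !(powRN u a) /c exprMn; ring.
Qed.

Let large_u : exists2 u1 : R, 0 < u1 & forall v, u1 <= v -> 0 < v /\ l < v `^ a.
Proof.
(* The factor 2 makes the inequality l < v^a strict already at the end point. *)
exists ((2 * l) `^ a^-1); first by rewrite powR_gt0 ?mulr_gt0.
move=> v uv; have v0 : 0 < v by rewrite (lt_le_trans _ uv)// powR_gt0 ?mulr_gt0.
split => //; have l2 : 0 <= 2 * l by rewrite mulr_ge0// ltW.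
apply: (@lt_le_trans _ _ (2 * l)); first by rewrite mulr_natl mulr2n ltrDl.
rewrite -[leLHS](powRr1 l2) -[X in _ `^ X](@mulVf _ a) ?gt_eqF//.
by rewrite powRrM ge0_ler_powR ?nnegrE ?powR_ge0 ?(ltW a0) ?(ltW v0).
Qed.

Let mf : measurable_fun (`]0%R, +oo[%classic : set R) f.
Proof.
have [u u0 Hu] := large_u; have [v0 lv] := Hu _ (lexx u).
have [/measurable_int/measurable_EFinP mfe _] := laplace_f v0 lv.
(* Measurability is known for the damped density, as a limit of partial sums; the damping is undone
   by its reciprocal. *)
apply: (eq_measurable_fun (fun x => f x * expR (- (u * x)) * expR (u * x))).
  by move=> x _; rewrite -mulrA -expRD addNr expR0 mulr1.
apply: measurable_funM; first exact: mfe.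
by apply: measurableT_comp => //; exact: measurable_funTS.
Qed.

Context d (Omega : measurableType d) (P : probability Omega R) (Z : {RV P >-> R}).
Hypothesis hZ : has_ML_density a l Z.

(* The density is not known to be nonnegative; integrating it over the set where
   it is negative gives a probability, so that set is null. *)
Let N : set R := `]0%R, +oo[%classic `&` [set x | f x < 0].
Let mN : measurable N.
Proof. by have := mf (measurable_itv _) (measurable_itv `]-oo, 0[); rewrite set_itvNyo. Qed.

Let N0 : mu N = 0%E.
Proof.
have mfN : measurable_fun N (fun x => (f x)%:E).
  apply/measurable_EFinP; apply: measurable_funS mf => //; exact: subIsetl.
have i0 : (\int[mu]_(x in N) `|(f x)%:E| = 0)%E.
  apply/eqP; rewrite eq_le; apply/andP; split; last exact: integral_ge0.
  rewrite -oppe_ge0 -integral_ge0N//.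
  rewrite (_ : integral _ _ _ = distribution P Z N); first exact: measure_ge0.
  rewrite hZ// (_ : N `&` _ = N); last by rewrite /N setIAC setIid.
  apply: eq_integral => x; rewrite inE => -[_ /= fx].
  by rewrite ltr0_norm ?opprK.
have [+ _] := ae_eq_integral_abs mu mN mfN; move=> /(_ i0).
move=> [M [mM M0 NM]]; apply/eqP; rewrite -measure_le0 -M0 le_measure ?inE//.
move=> x [Dx fx]; apply: NM => /= H.
by have := fx; rewrite /= (EFin_inj (H (conj Dx fx))) ltxx.
Qed.

(** The positive part of the density, extended by 0. It agrees with the density almost everywhere on
    the half line and supplies the nonnegative weight that [laplace_binomial_diff] and Tonelli ask
    for. *)
Let w (x : R) : R := Num.max (f x) 0 * \1_(`]0%R, +oo[%classic : set R) x.

Let w0 x : 0 <= w x.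
Proof. by rewrite /w mulr_ge0// le_max lexx orbT. Qed.

Let mw : measurable_fun setT w.
Proof.
rewrite (_ : w = (fun x => Num.max (f x) 0) \_ `]0%R, +oo[%classic); last first.
  by apply/funext => x; rewrite /w patch_indic.
apply/(measurable_restrictT _ _).1 => //.
exact: measurable_maxr.
Qed.

Let int_w (B : set R) (h : R -> R) : measurable B -> measurable_fun setT h ->
  (\int[mu]_(x in B) (w x * h x)%:E = \int[mu]_(x in B `&` `]0%R, +oo[) (f x * h x)%:E)%E.
Proof.
move=> mB mh.
have mBD : measurable (B `&` `]0%R, +oo[%classic) by exact: measurableI.
transitivity (\int[mu]_(x in B `&` `]0%R, +oo[) (w x * h x)%:E)%E.
  rewrite integral_mkcondr; apply: eq_integral => x _.
  rewrite patchE; case: ifPn => // Dx; rewrite /w indicE (negbTE Dx) mulr0 mul0r//.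
have mh' : measurable_fun (B `&` `]0%R, +oo[%classic) h by exact: measurable_funTS.
apply: ae_eq_integral => //.
- apply/measurable_EFinP; apply: measurable_funM => //; exact: measurable_funTS.
- apply/measurable_EFinP; apply: measurable_funM => //.
  apply: measurable_funS mf => //; exact: subIsetr.
exists N; split => // x /= /not_implyP[[Bx Dx] Hx]; split => //=.
rewrite ltNge; apply/negP => fx; apply: Hx.
by rewrite /w indicE mem_set// mulr1 max_l.
Qed.

Let laplace_w (g : R -> R) : measurable_fun setT g -> (forall x, 0 <= g x) ->
  (\int[P]_z (g (Z z))%:E = \int[mu]_x (w x * g x)%:E)%E.
Proof.
move=> mg g0.
have mgE : measurable_fun setT (fun x => (g x)%:E) by exact/measurable_EFinP.
have -> : (\int[P]_z (g (Z z))%:E = \int[distribution P Z]_x (g x)%:E)%E.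
  by rewrite ge0_integral_distribution// => x; rewrite lee_fin.
rewrite -[LHS]mul1e -(@integral_image_measure _ _ _ _ _ mu (distribution P Z) 1 id w)//.
- by apply: eq_integral => x _; rewrite -EFinM mulrC.
- move=> B mB; rewrite mul1e; apply: etrans; last by apply/esym; exact: hZ.
  transitivity (\int[mu]_(x in B) (w x * cst 1 x)%:E)%E.
    by apply: eq_integral => x _; rewrite mulr1.
  by rewrite int_w//; apply: eq_integral => x _; rewrite mulr1.
Qed.

Let w_pos x : w x != 0 -> 0 < x.
Proof.
rewrite /w indicE; case: (boolP (x \in _)) => [|_]; last by rewrite mulr0 eqxx.
by rewrite inE/= in_itv/= andbT.
Qed.

Let mexp (v : R) : measurable_fun setT (fun x : R => expR (- (v * x))).
Proof. by apply: measurableT_comp => //; exact: measurableT_comp. Qed.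

Let F1 (v : R) : R := fine (\int[mu]_x (w x * expR (- (v * x)))%:E).

Let F1E v : 0 <= v -> (\int[mu]_x (w x * expR (- (v * x)))%:E = (F1 v)%:E)%E.
Proof.
move=> v0; rewrite /F1 fineK// ge0_fin_numE; last first.
  by apply: integral_ge0 => x _; rewrite lee_fin mulr_ge0// expR_ge0.
apply: (@le_lt_trans _ _ (\int[mu]_x (w x * cst 1 x)%:E)%E).
  apply: ge0_le_integral => //.
  - by move=> x _; rewrite lee_fin mulr_ge0// expR_ge0.
  - by apply/measurable_EFinP; apply: measurable_funM => //; exact: mexp.
  - by apply/measurable_EFinP; apply: measurable_funM => //; exact: mexp.
  - move=> x _; rewrite lee_fin; have [->|/w_pos x0] := eqVneq (w x) 0.
      by rewrite !mul0r.
    by rewrite ler_wpM2l//= -expR0 ler_expR oppr_le0 mulr_ge0// ltW.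
by rewrite -(@laplace_w (cst 1))//= integral_cst//= probability_setT mule1 ltry.
Qed.

(** The power density whose Laplace transform is l v^(-a). *)
Let w3 (y : R) : R := l / Gamma a * (y `^ (a - 1) * \1_(`]0%R, +oo[%classic : set R) y).

Let w3_0 y : 0 <= w3 y.
Proof. by rewrite /w3 mulr_ge0 ?divr_ge0 ?mulr_ge0 ?powR_ge0// ltW// Gamma_gt0. Qed.

Let w3_pos y : w3 y != 0 -> 0 < y.
Proof.
rewrite /w3 indicE; case: (boolP (y \in _)) => [|_]; last by rewrite !mulr0 eqxx.
by rewrite inE/= in_itv/= andbT.
Qed.

Let mw3 : measurable_fun setT w3.
Proof.
apply: measurable_funM => //; apply: measurable_funM; first exact: measurable_powR.
exact: measurable_indic.
Qed.

Let F3 (v : R) : R := l * v `^ (- a).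

Let F3E v : 0 < v -> (\int[mu]_x (w3 x * expR (- (v * x)))%:E = (F3 v)%:E)%E.
Proof.
move=> v0.
have mpe := measurable_powR_expR (a - 1) v.
transitivity (\int[mu]_x (((l / Gamma a)%:E * (x `^ (a - 1) * expR (- (v * x)))%:E) *
    (\1_(`]0%R, +oo[%classic : set R) x)%:E))%E.
  by apply: eq_integral => x _; rewrite -!EFinM; congr EFin; rewrite /w3; ring.
transitivity (\int[mu]_(x in `]0%R, +oo[) ((l / Gamma a)%:E * (x `^ (a - 1) * expR (- (v * x)))%:E))%E.
  by rewrite [RHS]integral_mkcond; apply: eq_integral => x _; rewrite epatch_indic.
rewrite ge0_integralZl//; last 3 first.
- by apply: measurable_funTS; exact: mpe.
- by move=> x _; rewrite lee_fin mulr_ge0 ?powR_ge0 ?expR_ge0.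
- by rewrite lee_fin divr_ge0// ltW// Gamma_gt0.
by rewrite laplace_powR// -EFinM mulrA divfK// gt_eqF// Gamma_gt0.
Qed.

(** The product [F1 v * F3 v] is the transform of a convolution. It is represented by the product
    weight on the plane together with the sum of coordinates [X2], to which the difference series
    applies directly. *)
Let w2 (z : R * R) : R := w z.1 * w3 z.2.
Let X2 (z : R * R) : R := z.1 + z.2.

Let F2E v : 0 < v ->
  (\int[mu \x mu]_z (w2 z * expR (- (v * X2 z)))%:E = (F1 v * F3 v)%:E)%E.
Proof.
move=> v0; have v0' := ltW v0.
have mg : measurable_fun setT (fun z : R * R => (w2 z * expR (- (v * X2 z)))%:E).
  apply/measurable_EFinP; apply: measurable_funM.
    by apply: measurable_funM; exact: measurableT_comp.
  apply: measurableT_comp => //; apply: measurableT_comp => //.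
  by apply: measurable_funM => //; exact: measurable_funD.
rewrite fubini_tonelli1//=; last first.
  by move=> z; rewrite lee_fin mulr_ge0 ?expR_ge0// mulr_ge0.
rewrite /fubini_F.
transitivity (\int[mu]_x ((F3 v)%:E * (w x * expR (- (v * x)))%:E))%E.
  apply: eq_integral => x _.
  transitivity (\int[mu]_y ((w x * expR (- (v * x)))%:E * (w3 y * expR (- (v * y)))%:E))%E.
    apply: eq_integral => y _; rewrite -EFinM; congr EFin.
    by rewrite /w2 /X2/= mulrDr opprD expRD; ring.
  rewrite ge0_integralZl// ?F3E//; first by rewrite muleC.
  - by apply/measurable_EFinP; apply: measurable_funM => //; exact: mexp.
  - by move=> y _; rewrite lee_fin mulr_ge0// expR_ge0.
  - by rewrite lee_fin mulr_ge0// expR_ge0.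
rewrite ge0_integralZl// ?F1E//; first by rewrite EFinM muleC.
- by apply/measurable_EFinP; apply: measurable_funM => //; exact: mexp.
- by move=> y _; rewrite lee_fin mulr_ge0// expR_ge0.
- by rewrite lee_fin mulr_ge0 ?powR_ge0// ltW.
Qed.

(* The formula is equivalent to phi u + l u^(-a) phi u = l u^(-a), both sides of
   which are Laplace transforms of positive measures; so it is enough to know it
   for large u. *)
Lemma ML_law_laplace (u : R) : 0 <= u ->
  (\int[P]_z (expR (- (u * Z z)))%:E = (l / (u `^ a + l))%:E)%E.
Proof.
rewrite le_eqVlt => /predU1P[<-|u0].
  (* At u = 0 the measure with density [w3] has infinite mass, so this value is computed
     directly. *)
  under eq_integral do rewrite mul0r oppr0 expR0.
  rewrite integral_cst//= probability_setT mule1 powR0 ?gt_eqF// add0r divff//.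
  by rewrite gt_eqF.
have [e e0 He] := large_u.
rewrite (laplace_w (g := fun x => expR (- (u * x))))//.
have ev v : u + e <= v -> 0 < v by apply: lt_le_trans; exact: addr_gt0.
have D1 := @laplace_binomial_diff _ _ _ mu id w (@measurable_id _ _ _) mw w0
  (fun x wx => ltW (w_pos wx)) F1 u e e0 (fun v uv => F1E (ltW (ev v uv))).
have D3 := @laplace_binomial_diff _ _ _ mu id w3 (@measurable_id _ _ _) mw3 w3_0
  (fun x wx => ltW (w3_pos wx)) F3 u e e0 (fun v uv => F3E (ev v uv)).
have w2_0 z : 0 <= w2 z by rewrite mulr_ge0.
have mw2 : measurable_fun setT w2 by apply: measurable_funM; exact: measurableT_comp.
have mX2 : measurable_fun setT X2 by exact: measurable_funD.
have X2_0 z : w2 z != 0 -> 0 <= X2 z.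
  by rewrite mulf_eq0 negb_or => /andP[/w_pos z1 /w3_pos z2]; rewrite ltW// addr_gt0.
have D2 := @laplace_binomial_diff _ _ _ (mu \x mu)%E X2 w2 mX2 mw2 w2_0
  X2_0 (fun v => F1 v * F3 v) u e e0 (fun v uv => F2E (ev v uv)).
have F1_large v : u + e <= v -> F1 v + F1 v * F3 v = F3 v.
  move=> uv; have v0 := ev _ uv.
  have [_ lv] : 0 < v /\ l < v `^ a by apply: He; rewrite (le_trans _ uv)// lerDr ltW.
  have va : 0 < v `^ a by exact: lt_trans lv.
  have -> : F1 v = l / (v `^ a + l).
    apply: EFin_inj; rewrite -F1E ?ltW// int_w// setTI.
    by have [_ ->] := laplace_f v0 lv.
  by rewrite /F3 powRN; field; rewrite !gt_eqF// addr_gt0.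
(* Binomial differences are linear in the transform and only evaluate it on [u + e, +oo[, where
   [F1_large] holds; hence the series on the two sides agree term by term. *)
have E : ((F1 u)%:E + (F1 u * F3 u)%:E = (F3 u)%:E)%E.
  have u0' := ltW u0.
  rewrite -F1E// -F2E// -F3E// D1 D2 D3.
  rewrite -nneseriesD.
  - apply: eq_eseriesr => k _; rewrite -EFinD; congr EFin.
    rewrite /binomial_diff -big_split/=; apply: eq_bigr => j _.
    by rewrite -mulrDr F1_large// lerDl mulrn_wge0// ltW.
  - move=> k _ _; rewrite lee_fin.
    by apply: (@binomial_diff_ge0 _ _ _ mu id w) => //; [move=> x /w_pos/ltW|move=> v /ev/ltW/F1E].
  - move=> k _ _; rewrite lee_fin.
    by apply: (@binomial_diff_ge0 _ _ _ (mu \x mu)%E X2 w2) => // v /ev/F2E.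
rewrite F1E ?ltW//; congr EFin; have := EFin_inj E; rewrite /F3 powRN => E1.
have ua : 0 < u `^ a by rewrite powR_gt0.
have nz : u `^ a + l != 0 by rewrite gt_eqF// addr_gt0.
apply: (mulIf nz); rewrite divfK//.
have : (F1 u + F1 u * (l / u `^ a)) * u `^ a = l / u `^ a * u `^ a by rewrite E1.
by rewrite divfK ?gt_eqF// => H; rewrite -[RHS]H; field; rewrite gt_eqF.
Qed.

Lemma ML_law_le0 : P [set z | Z z <= 0] = 0%E.
Proof.
have -> : [set z | Z z <= 0] = Z @^-1` `]-oo, 0] by apply/seteqP; split=> z /=; rewrite in_itv.
rewrite -[LHS]/(distribution P Z _) hZ// (_ : _ `&` _ = set0) ?integral_set0//.
by apply/seteqP; split => // x [] /=; rewrite !in_itv/= andbT => x0; rewrite ltNge x0.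
Qed.
End ML_law.

Lemma exprmxS {R : pzRingType} {n : nat} (A : 'M[R]_n) k i j :
  (A ^+ k.+1) i j = \sum_l A i l * (A ^+ k) l j.
Proof. by rewrite exprS [LHS]mxE. Qed.

(** * Transient chains and matrix geometric series *)

Section transience.
Context {R : realType} {m : nat} (Q : 'M[R]_m).
Hypothesis stQ : stochastic Q.
Let Q0 i j : 0 <= Q i j. Proof. by case: stQ. Qed.

Lemma exprmx_ge0 n i j : 0 <= (Q ^+ n) i j.
Proof.
elim: n i j => [|n IH] i j; first by rewrite expr0 !mxE; case: eqP.
by rewrite exprmxS sumr_ge0// => k _; rewrite mulr_ge0.
Qed.

Lemma first_passage_ge0 n i j : 0 <= first_passage Q n i j.
Proof.
elim: n i => [|n IH] i; first exact: Q0.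
by apply: sumr_ge0 => k _; rewrite mulr_ge0.
Qed.

Lemma sum_first_passageS n i j : \sum_(k < n.+1) first_passage Q k i j =
  Q i j + \sum_(l | l != j) Q i l * \sum_(k < n) first_passage Q k l j.
Proof.
rewrite big_ord_recl/=; congr (_ + _).
under [RHS]eq_bigr do rewrite big_distrr/=.
by rewrite exchange_big.
Qed.

Lemma sum_first_passage_le1 n i j : \sum_(k < n) first_passage Q k i j <= 1.
Proof.
elim: n i => [|n IH] i; first by rewrite big_ord0.
rewrite sum_first_passageS; have [_ /(_ i) <-] := stQ.
by rewrite [leRHS](bigD1 j)//= lerD2l ler_sum// => l _; rewrite ler_piMr.
Qed.

(** First-passage decomposition of the expected number of visits to [j]: after the first visit the
    chain restarts from [j]. Cutting both sums at n admits extra terms on the right, hence an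
    inequality; the induction conditions on the first step. *)
Lemma sum_exprmx_le n i j : \sum_(k < n) (Q ^+ k.+1) i j <=
  (\sum_(k < n) first_passage Q k i j) * \sum_(k < n) (Q ^+ k) j j.
Proof.
elim: n i => [|n IH] i; first by rewrite !big_ord0 mulr0.
set U := \sum_(k < n.+1) (Q ^+ k) j j.
have U0 : 0 <= U by rewrite sumr_ge0// => k _; exact: exprmx_ge0.
have -> : \sum_(k < n.+1) (Q ^+ k.+1) i j =
    \sum_l Q i l * \sum_(k < n.+1) (Q ^+ k) l j.
  under [RHS]eq_bigr do rewrite big_distrr/=.
  by rewrite exchange_big; apply: eq_bigr => k _; rewrite exprmxS.
rewrite sum_first_passageS mulrDl (bigD1 j)//= lerD2l big_distrl/=.
apply: ler_sum => l lj; rewrite -mulrA ler_wpM2l//.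
rewrite big_ord_recl expr0 mxE (negbTE lj) add0r.
apply: (le_trans (IH l)); rewrite ler_wpM2l//.
  by rewrite sumr_ge0// => k _; exact: first_passage_ge0.
by rewrite /U big_ord_recr/= lerDl exprmx_ge0.
Qed.

(** With F < 1 the return probability, the truncated visit counts U_n satisfy U_(n+1) <= 1 + F U_n,
    so they stay below the fixed point 1 / (1 - F). The series of n-step probabilities then
    converges and its terms tend to 0. *)
Lemma transient_exprmx_cvg0 i j : transient Q j -> (Q ^+ n) i j @[n --> \oo] --> 0.
Proof.
move=> trj; pose F := (\sum_(0 <= n <oo) (first_passage Q n j j)%:E)%E.
have FF : F = (fine F)%:E.
  rewrite fineK// ge0_fin_numE ?(lt_trans trj) ?ltry//.
  by apply: nneseries_ge0 => n _ _; rewrite lee_fin first_passage_ge0.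
have F1 : fine F < 1 by rewrite -lte_fin -FF.
have F0 : 0 <= fine F.
  by apply: fine_ge0; apply: nneseries_ge0 => n _ _; rewrite lee_fin first_passage_ge0.
have SF n : \sum_(k < n) first_passage Q k j j <= fine F.
  rewrite -lee_fin -FF -(big_mkord xpredT (fun k => first_passage Q k j j)) -sumEFin.
  by apply: nneseries_lim_ge => k _ _; rewrite lee_fin first_passage_ge0.
have UF n : \sum_(k < n) (Q ^+ k) j j <= (1 - fine F)^-1.
  elim: n => [|n IH]; first by rewrite big_ord0 invr_ge0 subr_ge0 ltW.
  rewrite big_ord_recl expr0 mxE eqxx/=.
  apply: (@le_trans _ _ (1 + fine F * (1 - fine F)^-1)).
    rewrite lerD2l; apply: (le_trans (sum_exprmx_le _ _ _)).
    rewrite ler_pM//; apply: sumr_ge0 => k _; [exact: first_passage_ge0|exact: exprmx_ge0].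
  by rewrite le_eqVlt; apply/orP; left; apply/eqP; field; rewrite gt_eqF// subr_gt0.
suff : cvgn (series (fun n => (Q ^+ n.+1) i j)).
  by move=> /cvg_series_cvg_0; rewrite (cvg_shiftS (fun n => (Q ^+ n) i j)).
apply: nondecreasing_is_cvgn.
  by apply/nondecreasing_seqP => n; rewrite /series/= big_nat_recr//= lerDl exprmx_ge0.
exists (1 - fine F)^-1 => _ [n _ <-]; rewrite /series/= big_mkord.
apply: (le_trans (sum_exprmx_le _ _ _)); rewrite -[leRHS]mul1r ler_pM//.
- by apply: sumr_ge0 => k _; exact: first_passage_ge0.
- by apply: sumr_ge0 => k _; exact: exprmx_ge0.
- exact: sum_first_passage_le1.
Qed.
End transience.

Section geometric_matrix.
Context {R : realType} {p : nat} (A : 'M[R]_p).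

Lemma expr_block_mx (b : 'cV[R]_p) n :
  exists v, (block_mx A b 0 1%:M : 'M[R]_(p + 1)) ^+ n = block_mx (A ^+ n) v 0 1%:M.
Proof.
elim: n => [|n [v IH]].
  by exists 0; rewrite !expr0 -scalar_mx_block.
exists (A *m v + b); rewrite exprS IH -[LHS]/(_ *m _) mulmx_block.
by rewrite !mul0mx !mulmx0 !mulmx1 !addr0 add0r exprS.
Qed.

Hypothesis A0 : forall i j, (A ^+ n) i j @[n --> \oo] --> 0.

Lemma exprmx_mul_cvg0 (y : 'cV[R]_p) i : (A ^+ n *m y) i 0 @[n --> \oo] --> 0.
Proof.
under eq_fun do rewrite mxE.
have : (\sum_j (A ^+ n) i j * y j 0) @[n --> \oo] --> \sum_(j < p) 0 * y j 0.
  by apply: cvg_big => [|j _]; [exact: add_continuous|]; apply: cvgMl; exact: A0.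
suff -> : \sum_(j < p) 0 * y j 0 = 0 by [].
by rewrite big1// => j _; rewrite mul0r.
Qed.

(** Since r = y - A y, the partial sums telescope to y - A^n y. The sum of the series is thus
    identified by a fixed-point equation. *)
Lemma geometric_mx_cvg (y r : 'cV[R]_p) i : y = r + A *m y ->
  (\sum_(0 <= k < n) (A ^+ k *m r) i 0) @[n --> \oo] --> y i 0.
Proof.
move=> yr.
have E n : \sum_(0 <= k < n) (A ^+ k *m r) i 0 = y i 0 - (A ^+ n *m y) i 0.
  elim: n => [|n IH]; first by rewrite big_geq// expr0 mul1mx subrr.
  rewrite big_nat_recr//= IH [in (A ^+ n *m y) _ _]yr mulmxDr mxE.
  rewrite mulmxA -[(_ *m A)]/(A ^+ n * A) -exprSr; ring.
under eq_fun do rewrite E.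
have : y i 0 - (A ^+ n *m y) i 0 @[n --> \oo] --> y i 0 - 0.
  by apply: cvgB; [exact: cvg_cst|exact: exprmx_mul_cvg0].
by rewrite subr0.
Qed.

(** A vector fixed by [A] equals its image under every A^n, hence is 0. The transposes translate the
    criterion on row vectors into one on columns. *)
Lemma unitmx_1B : 1%:M - A \in unitmx.
Proof.
rewrite -unitmx_tr -row_free_unit; apply: inj_row_free => v.
move=> /(congr1 trmx); rewrite trmx_mul trmxK trmx0 mulmxBl mul1mx => /eqP.
rewrite subr_eq0 => /eqP vE.
have E n : v^T = A ^+ n *m v^T.
  elim: n => [|n IH]; first by rewrite expr0 mul1mx.
  by rewrite exprS -[A * _]/(A *m _) -mulmxA -IH.
apply: trmx_inj; rewrite trmx0; apply/colP => i; rewrite [RHS]mxE.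
have := @exprmx_mul_cvg0 v^T i; under eq_fun do rewrite -E.
by move=> /(cvg_unique _ (cvg_cst _)) H; apply: H.
Qed.
End geometric_matrix.

Lemma le_exprmx {R : realType} {p : nat} (A B : 'M[R]_p) :
  (forall i j, 0 <= A i j <= B i j) -> forall n i j, 0 <= (A ^+ n) i j <= (B ^+ n) i j.
Proof.
move=> AB; elim=> [|n IH] i j; first by rewrite !expr0 !mxE; case: eqP => _; rewrite !lexx ?ler01.
rewrite !exprmxS; apply/andP; split.
  by apply: sumr_ge0 => k _; have /andP[? _] := AB i k; have /andP[? _] := IH k j; rewrite mulr_ge0.
apply: ler_sum => k _; have /andP[? ?] := AB i k; have /andP[? ?] := IH k j.
exact: ler_pM.
Qed.

(** * Uniqueness for Laplace transforms *)

Lemma bernoulli_ineq {R : realType} (z : R) n : 0 <= z <= 1 -> 1 - n%:R * z <= (1 - z) ^+ n.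
Proof.
move=> /andP[z0 z1]; elim: n => [|n IH]; first by rewrite mul0r subr0 expr0.
rewrite exprS; apply: (@le_trans _ _ ((1 - z) * (1 - n%:R * z))); last first.
  by rewrite ler_wpM2l// subr_ge0.
rewrite -natr1 -subr_ge0 (_ : _ - _ = n%:R * z ^+ 2); last by ring.
by rewrite mulr_ge0// exprn_ge0.
Qed.

Section laplace_injective.
Context {R : realType} (D : R -> R).
Local Notation mu := (@lebesgue_measure R).
Hypothesis iD : mu.-integrable `]0%R, +oo[ (fun x => (D x)%:E).
Hypothesis lD : forall u : R, 0 <= u ->
  (\int[mu]_(x in `]0%R, +oo[) (D x * expR (- (u * x)))%:E = 0)%E.

Let iDe (u : R) : 0 <= u -> mu.-integrable `]0%R, +oo[ (fun x => (D x * expR (- (u * x)))%:E).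
Proof.
move=> u0; apply: (le_integrable _ _ _ iD) => //.
- have /measurable_EFinP mD := measurable_int _ iD.
  apply/measurable_EFinP; apply: measurable_funM => //.
  by apply: measurableT_comp => //; apply: measurableT_comp => //; exact: measurable_funM.
- move=> x; rewrite /= in_itv/= andbT => x0; rewrite lee_fin normrM.
  rewrite (ger0_norm (expR_ge0 _)) ler_piMr// -expR0 ler_expR oppr_le0 mulr_ge0//.
  exact: ltW.
Qed.

Section kernel.
Variable t : R.
Hypothesis t0 : 0 < t.
Let s : R := ln 2 / t.
Let s0 : 0 < s. Proof. by rewrite divr_gt0// ln_gt0// ltr1n. Qed.

(* Converges pointwise to the indicator of ]t, +oo[, except at t: by the choice
   of s, 2 * exp (- (s * x)) < 1 iff x > t. *)
Let kern (n : nat) (x : R) : R := (1 - expR (- (s * x)) ^+ n) ^+ (2 ^ n).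

Let kern01 n x : 0 < x -> 0 <= kern n x <= 1.
Proof.
move=> x0; have y0 : 0 <= expR (- (s * x)) by exact: expR_ge0.
have y1 : expR (- (s * x)) <= 1 by rewrite -expR0 ler_expR oppr_le0 mulr_ge0// ltW.
have ? : 0 <= 1 - expR (- (s * x)) ^+ n by rewrite subr_ge0 exprn_ile1.
rewrite /kern exprn_ge0// exprn_ile1// lerBlDr lerDl exprn_ge0//.
Qed.

Let kern_gt x : t < x -> kern n x @[n --> \oo] --> (1 : R).
Proof.
move=> tx; have x0 : 0 < x by exact: lt_trans tx.
pose q := 2 * expR (- (s * x)).
have q1 : q < 1.
  rewrite /q -[X in X * _](@lnK _ 2) ?posrE// -expRD -[X in _ < X]expR0 ltr_expR.
  by rewrite subr_lt0 /s mulrAC ltr_pdivlMr// ltr_pM2l// ln_gt0// ltr1n.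
have q0 : 0 <= q by rewrite mulr_ge0// expR_ge0.
have H : 1 - q ^+ n @[n --> \oo] --> (1 - 0 : R).
  apply: cvgB; first exact: cvg_cst.
  have := @cvg_geometric R 1 q; rewrite ger0_norm// => /(_ q1).
  by rewrite -exprn_geometric.
rewrite subr0 in H; apply: (squeeze_cvgr _ H (cvg_cst _)).
apply: nearW => n; have /andP[_ ->] := kern01 n x0; rewrite andbT.
(* Bernoulli's inequality bounds the kernel below by 1 - 2^n exp(-(s x))^n = 1 - q^n. *)
have /(bernoulli_ineq (2 ^ n)) : 0 <= expR (- (s * x)) ^+ n <= 1.
  rewrite exprn_ge0 ?expR_ge0//= exprn_ile1 ?expR_ge0//.
  by rewrite -expR0 ler_expR oppr_le0 mulr_ge0// ltW.
by rewrite natrX -exprMn.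
Qed.

Let kern_lt x : 0 < x -> x < t -> kern n x @[n --> \oo] --> (0 : R).
Proof.
move=> x0 xt; pose q := 2 * expR (- (s * x)).
have q1 : 1 < q.
  rewrite /q -[X in X * _](@lnK _ 2) ?posrE// -expRD -[X in X < _]expR0 ltr_expR.
  by rewrite subr_gt0 /s mulrAC ltr_pdivrMr// ltr_pM2l// ln_gt0// ltr1n.
have q0 : 0 < q by exact: lt_trans q1.
have H : (q^-1) ^+ n @[n --> \oo] --> (0 : R).
  have := @cvg_geometric R 1 q^-1; rewrite gtr0_norm ?invr_gt0// invf_lt1// => /(_ q1).
  by rewrite -exprn_geometric.
apply: (squeeze_cvgr _ (cvg_cst _) H); apply: nearW => n.
have /andP[-> _] /= := kern01 n x0.
set z := expR (- (s * x)) ^+ n.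
have z1 : 0 <= 1 - z.
  rewrite subr_ge0 exprn_ile1 ?expR_ge0//.
  by rewrite -expR0 ler_expR oppr_le0 mulr_ge0// ltW.
(* With N = 2^n one has N z = q^n, and (1 - z)^N <= exp(-N z) <= 1 / (N z). *)
apply: (@le_trans _ _ (expR (- z) ^+ (2 ^ n))).
  by rewrite lerXn2r ?nnegrE ?expR_ge0// expR_ge1Dx.
rewrite -expRM_natl mulrN expRN exprVn lef_pV2 ?posrE ?expR_gt0 ?exprn_gt0//.
rewrite natrX /z -exprMn; apply: le_trans (expR_ge1Dx _); by rewrite lerDr.
Qed.

(** Expanding the outer power gives a combination of the exponentials exp(-(n j s x)), at each of
    which the transform of [D] vanishes. *)
Let kern_int n : (\int[mu]_(x in `]0%R, +oo[) (D x * kern n x)%:E = 0)%E.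
Proof.
have e0 (j : nat) : 0 <= (n * j)%:R * s by rewrite mulr_ge0// ltW.
have E x : (D x * kern n x)%:E = (\sum_(j < (2 ^ n).+1)
   (((-1) ^+ j * 'C(2 ^ n, j)%:R)%:E * (D x * expR (- (((n * j)%:R * s) * x)))%:E))%E.
  rewrite /kern exprBn big_distrr/= -sumEFin; apply: eq_bigr => j _.
  rewrite -EFinM; congr EFin; rewrite expr1n mulr1 -exprM -expRM_natl -mulr_natl.
  rewrite (_ : (n * j)%:R * - (s * x) = - ((n * j)%:R * s * x)); last by ring.
  by set y := expR _; ring.
under eq_integral do rewrite E.
rewrite integral_sum//; last by move=> j; apply: integrableZl => //; exact: iDe.
by rewrite big1// => j _; rewrite (integralZl _ (iDe (e0 j)))// lD// mule0.
Qed.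

Lemma laplace_eq0_tail : (\int[mu]_(x in `]t, +oo[) (D x)%:E = 0)%E.
Proof.
have /measurable_EFinP mD := measurable_int _ iD.
have mk n : measurable_fun setT (kern n).
  apply: measurable_funX; apply: measurable_funB => //; apply: measurable_funX.
  by apply: measurableT_comp => //; apply: measurableT_comp => //; exact: measurable_funM.
have [] := @dominated_convergence _ _ _ mu `]0%R, +oo[%classic (measurable_itv _)
  (fun n x => (D x * kern n x)%:E)
  (fun x => (D x * \1_(`]t, +oo[%classic : set R) x)%:E) (fun x => `|(D x)%:E|%E).
- move=> n; apply/measurable_EFinP; apply: measurable_funM => //.
  by apply: measurable_funTS; exact: mk.
- apply/measurable_EFinP; apply: measurable_funM => //.
- exists [set t]; split => //; first exact: lebesgue_measure_set1.
  move=> x /= /not_implyP[x0 Hx]; apply: contrapT => xt; apply: Hx.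
  move: x0; rewrite in_itv/= andbT => x0.
  apply: cvg_EFin; first exact: nearW.
  apply: cvgMr; rewrite indicE; case: (ltgtP t x) => [tx|xt'|]; last by move/esym.
  + rewrite (_ : (x \in (`]t, +oo[%classic : set R)) = true); first exact: kern_gt.
    by apply/mem_set; rewrite /= in_itv/= tx.
  + rewrite (_ : (x \in (`]t, +oo[%classic : set R)) = false); first exact: kern_lt.
    by apply/negbTE/negP => /set_mem; rewrite /= in_itv/= andbT ltNge ltW.
- exact: integrable_abse.
- apply: aeW => x n; rewrite /= in_itv/= andbT => x0; rewrite lee_fin normrM.
  by have /andP[k0 k1] := kern01 n x0; rewrite (ger0_norm k0) ler_piMr.
move=> _ _; under eq_fun do rewrite kern_int.
move=> /(cvg_unique _ (cvg_cst _)) H.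
transitivity (\int[mu]_(x in `]0%R, +oo[) (D x * \1_(`]t, +oo[%classic : set R) x)%:E)%E; last first.
  by apply/esym/H.
have E : `]t, +oo[%classic = `]0, +oo[%classic `&` `]t, +oo[%classic :> set R.
  apply/seteqP; split => x/=; rewrite !in_itv/= !andbT; last by case.
  by move=> tx; rewrite (lt_trans t0 tx).
rewrite [in LHS]E integral_mkcondr; apply: eq_integral => x _.
by rewrite patchE indicE; case: ifPn => _; rewrite ?mulr1// mulr0.
Qed.
End kernel.
End laplace_injective.

Section laplace_unique.
Context {R : realType} (F H : R -> R) (v : R).
Local Notation mu := (@lebesgue_measure R).
Hypothesis v0 : 0 < v.
Hypothesis iF : mu.-integrable `]0%R, +oo[ (fun x => (F x * expR (- (v * x)))%:E).
Hypothesis iH : mu.-integrable `]0%R, +oo[ (fun x => (H x * expR (- (v * x)))%:E).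
Hypothesis FH : forall u : R, v <= u ->
  (\int[mu]_(x in `]0%R, +oo[) (F x * expR (- (u * x)))%:E =
   \int[mu]_(x in `]0%R, +oo[) (H x * expR (- (u * x)))%:E)%E.
Hypothesis F_nd : forall x y : R, 0 <= x -> x <= y -> F x <= F y.
Hypothesis H_cont : forall t : R, 0 < t -> {for t, continuous H}.
Hypothesis H_cont0 : H x @[x --> 0^'+] --> H 0.

(** The damping by exp(-(v x)) makes the difference integrable and moves the range u >= v, where the
    transforms are known to agree, to u >= 0. *)
Let D x := (F x - H x) * expR (- (v * x)).

Let int_shift (G : R -> R) (u : R) : 0 <= u ->
  mu.-integrable `]0%R, +oo[ (fun x => (G x * expR (- (v * x)))%:E) ->
  mu.-integrable `]0%R, +oo[ (fun x => (G x * expR (- ((v + u) * x)))%:E).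
Proof.
move=> u0 iG; have /measurable_EFinP mG := measurable_int _ iG.
have E x : G x * expR (- ((v + u) * x)) = G x * expR (- (v * x)) * expR (- (u * x)).
  by rewrite -mulrA -expRD; congr (_ * expR _); ring.
apply: (le_integrable _ _ _ iG) => //.
- apply/measurable_EFinP.
  apply: (eq_measurable_fun (fun x => G x * expR (- (v * x)) * expR (- (u * x)))).
    by move=> x _; rewrite -E.
  apply: measurable_funM => //.
  by apply: measurableT_comp => //; apply: measurableT_comp => //; exact: measurable_funM.
- move=> x; rewrite /= in_itv/= andbT => x0; rewrite lee_fin E [leLHS]normrM.
  rewrite (ger0_norm (expR_ge0 (- (u * x)))) ler_piMr// -expR0 ler_expR oppr_le0 mulr_ge0//.
  exact: ltW.
Qed.

Let iD : mu.-integrable `]0%R, +oo[ (fun x => (D x)%:E).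
Proof.
have := @integrableB _ _ _ mu `]0%R, +oo[%classic (measurable_itv _) _ _ iF iH; apply: eq_integrable => //.
by move=> x _; rewrite -EFinB -mulrBl.
Qed.

Let lD (u : R) : 0 <= u -> (\int[mu]_(x in `]0%R, +oo[) (D x * expR (- (u * x)))%:E = 0)%E.
Proof.
move=> u0; have i1 := int_shift u0 iF; have i2 := int_shift u0 iH.
transitivity (\int[mu]_(x in `]0%R, +oo[) ((F x * expR (- ((v + u) * x)))%:E
    - (H x * expR (- ((v + u) * x)))%:E))%E.
  apply: eq_integral => x _; rewrite -EFinB; congr EFin; rewrite /D -mulrBl -mulrA -expRD.
  by congr (_ * expR _); ring.
rewrite integralB// FH ?lerDl// subee//.
exact: integrable_fin_num.
Qed.

Let int_itv (s s' : R) : 0 <= s -> s < s' -> (\int[mu]_(x in `]s, s']) (D x)%:E = 0)%E.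
Proof.
move=> s0 ss'.
have T t : 0 <= t -> (\int[mu]_(x in `]t, +oo[) (D x)%:E = 0)%E.
  rewrite le_eqVlt => /predU1P[<-|t0]; last exact: laplace_eq0_tail.
  by rewrite -(lD (lexx 0)); apply: eq_integral => x _; rewrite mul0r oppr0 expR0 mulr1.
have sub : `]s, +oo[%classic `<=` (`]0, +oo[%classic : set R).
  by move=> x/=; rewrite !in_itv/= !andbT; exact: le_lt_trans.
have E : `]s, +oo[%classic = `]s, s']%classic `|` `]s', +oo[%classic :> set R.
  apply/seteqP; split => x /=; rewrite !in_itv/= !andbT.
    by move=> ->/=; case: (leP x s') => h; [left|right].
  by case=> [/andP[]//|]; exact: lt_trans.
have := T s s0; rewrite E integral_setU//.
- by rewrite (T s') ?adde0// (le_trans s0)// ltW.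
- by rewrite -E; apply: measurable_funS (measurable_int _ iD).
- apply/disj_setPS => x [] /=; rewrite !in_itv/= => /andP[_ x1]; rewrite andbT.
  by rewrite ltNge x1.
Qed.

Let not_pos (s s' e : R) : 0 <= s -> s < s' -> 0 < e ->
  (forall x, s < x -> x <= s' -> e <= F x - H x) -> False.
Proof.
move=> s0 ss' e0 He.
have s'0 : 0 < s' by exact: le_lt_trans ss'.
have mD : measurable_fun (`]s, s']%classic : set R) (fun x => (D x)%:E).
  apply: measurable_funS (measurable_int _ iD) => //.
  by move=> x/=; rewrite !in_itv/= andbT => /andP[+ _]; exact: le_lt_trans.
have h : ((e * expR (- (v * s')))%:E * (s' - s)%:E <= 0)%E.
  rewrite -(int_itv s0 ss').
  have -> : (s' - s)%:E = mu `]s, s'] by rewrite lebesgue_measure_itv/= lte_fin ss' EFinB.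
  rewrite -integral_cst//; apply: ge0_le_integral => //.
  - by move=> x _; rewrite lee_fin mulr_ge0 ?expR_ge0// ltW.
  - move=> x; rewrite /= in_itv/= => /andP[sx xs]; rewrite lee_fin /D.
    rewrite ler_pM ?expR_ge0 ?(ltW e0) ?He//.
    by rewrite ler_expR lerN2 ler_pM2l.
move: h; rewrite -EFinM lee_fin leNgt => /negP; apply.
by rewrite mulr_gt0 ?subr_gt0// mulr_gt0 ?expR_gt0.
Qed.

Let not_neg (s s' e : R) : 0 <= s -> s < s' -> 0 < e ->
  (forall x, s < x -> x <= s' -> e <= H x - F x) -> False.
Proof.
move=> s0 ss' e0 He.
have s'0 : 0 < s' by exact: le_lt_trans ss'.
have mD : measurable_fun (`]s, s']%classic : set R) (fun x => (D x)%:E).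
  apply: measurable_funS (measurable_int _ iD) => //.
  by move=> x/=; rewrite !in_itv/= andbT => /andP[+ _]; exact: le_lt_trans.
have D0 x : `]s, s']%classic x -> (e * expR (- (v * s')) <= - D x).
  rewrite /= in_itv/= => /andP[sx xs]; rewrite [leRHS](_ : _ = (H x - F x) * expR (- (v * x))); last by rewrite /D; ring.
  by rewrite ler_pM ?expR_ge0 ?(ltW e0) ?He// ler_expR lerN2 ler_pM2l.
have h : ((e * expR (- (v * s')))%:E * (s' - s)%:E <= 0)%E.
  rewrite -[leRHS]oppe0 -(int_itv s0 ss').
  have c0 : 0 <= e * expR (- (v * s')) by rewrite mulr_ge0 ?expR_ge0// ltW.
  have -> : (- (\int[mu]_(x in `]s, s']) (D x)%:E) = \int[mu]_(x in `]s, s']) (- D x)%:E)%E.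
    under [in RHS]eq_integral do rewrite EFinN.
    rewrite integralN//; apply: integrable_add_def => //; apply: integrableS iD => //.
    by move=> x/=; rewrite !in_itv/= andbT => /andP[+ _]; exact: le_lt_trans.
  have -> : (s' - s)%:E = mu `]s, s'] by rewrite lebesgue_measure_itv/= lte_fin ss' EFinB.
  rewrite -integral_cst//; apply: ge0_le_integral => //.
  by apply/measurable_EFinP; apply: measurableT_comp => //; apply/measurable_EFinP.
move: h; rewrite -EFinM lee_fin leNgt => /negP; apply.
by rewrite mulr_gt0 ?subr_gt0// mulr_gt0 ?expR_gt0.
Qed.

Let H_right (t e : R) : 0 <= t -> 0 < e -> exists2 r, 0 < r & forall x, t < x -> x <= t + r -> `|H t - H x| < e.
Proof.
move=> t0 e0.
have : \forall x \near t^'+, `|H t - H x| < e.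
  move: t0; rewrite le_eqVlt => /predU1P[<-|t0].
    by move/cvgrPdist_lt : H_cont0; exact.
  by have /cvg_at_right_filter/cvgrPdist_lt := H_cont t0; exact.
move=> [r /= r0 Hr]; exists (r / 2); first by rewrite divr_gt0.
move=> x tx xr; apply: Hr => //=.
by rewrite ltr0_norm ?subr_lt0// opprB; lra.
Qed.

Let H_left (t e : R) : 0 < t -> 0 < e -> exists2 r, 0 < r <= t & forall x, t - r < x -> x <= t -> `|H t - H x| < e.
Proof.
move=> t0 e0; have /cvgrPdist_lt/(_ _ e0) [r /= r0 Hr] := H_cont t0.
exists (Num.min (r / 2) t); first by rewrite lt_min t0 divr_gt0// ge_min lexx orbT.
move=> x tx xt; apply: Hr => //=; rewrite ger0_norm ?subr_ge0//.
have : Num.min (r / 2) t <= r / 2 by rewrite ge_min lexx.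
lra.
Qed.

(** If F t > H t, monotonicity of [F] and right continuity of [H] keep a positive gap on an interval
    to the right of t, contradicting [not_pos]. Only points to the right are involved, so t = 0 is
    included. *)
Lemma laplace_unique_le t : 0 <= t -> F t <= H t.
Proof.
move=> t0; rewrite leNgt; apply/negP => HF.
have e0 : 0 < (F t - H t) / 2 by rewrite divr_gt0// subr_gt0.
have [r r0 Hr] := H_right t0 e0.
apply: (@not_pos t (t + r) _ t0 _ e0); first by rewrite ltrDl.
move=> x tx xr; have := F_nd t0 (ltW tx); have := Hr _ tx xr.
by rewrite ltr_norml => /andP[? ?]; lra.
Qed.

(** A gap in the other direction propagates to the left of t instead, whence the restriction to t >
    0. *)
Lemma laplace_unique_eq t : 0 < t -> F t = H t.
Proof.
move=> t0; apply/eqP; rewrite eq_le laplace_unique_le ?(ltW t0)//= leNgt; apply/negP => HF.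
have e0 : 0 < (H t - F t) / 2 by rewrite divr_gt0// subr_gt0.
have [r /andP[r0 rt] Hr] := H_left t0 e0.
apply: (@not_neg (t - r) t _ _ _ e0); rewrite ?subr_ge0// ?gtrBl//.
move=> x tx xt; have x0 : 0 <= x by rewrite (le_trans _ (ltW tx))// subr_ge0.
have := F_nd x0 xt; have := Hr _ tx xt.
by rewrite ltr_norml => /andP[? ?]; lra.
Qed.
End laplace_unique.

(** * Expectations along paths of the chain *)

Section independence.
Context {d} {Omega : measurableType d} {R : realType} (P : probability Omega R).
Context {p : nat} (Y : nat -> Omega -> 'I_(p + 1)) (W : 'I_p -> nat -> {RV P >-> R}).
Hypothesis hindep : mutually_independent P (sojourn_chain_sigma W Y).
Variables (n : nat) (s : nat -> 'I_p) (C : set Omega).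
Hypotheses (mC : measurable C) (YC : sigma_chain Y C).

Let mW i k : measurable_fun setT (W i k). Proof. exact: measurable_funPT. Qed.

Let mWB i k (B : set R) : measurable B -> measurable (W i k @^-1` B).
Proof. by move=> mB; rewrite -[_ @^-1` _]setTI; exact: mW. Qed.

Lemma independent_sojourns_cap (B : 'I_n -> set R) : (forall m, measurable (B m)) ->
  P (C `&` [set w | forall m : 'I_n, B m (W (s m) m w)]) =
  (P C * \prod_(m < n) P (W (s m) m @^-1` B m))%E.
Proof.
move=> mB.
(* A path may revisit a state, but the sojourn number m differs at each step, so the indices (s m,
   m) are distinct; [None] stands for the event of the chain. *)
pose r := None :: [seq Some (s (m : 'I_n), val m) | m <- enum 'I_n].
have ur : uniq r.
  rewrite /= map_inj_uniq ?enum_uniq ?andbT; first by apply/mapP => -[].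
  by move=> i j [_ /val_inj].
pose A (o : option ('I_p * nat)) : set Omega := if o is Some (i, k) then
  (if insub k is Some m then W i k @^-1` B m else setT) else C.
have Am (m : 'I_n) : A (Some (s m, val m)) = W (s m) m @^-1` B m by rewrite /A valK.
pose J : {fset option ('I_p * nat)} := seq_fset tt r.
have JA j : j \in J -> sojourn_chain_sigma W Y j (A j).
  case: j => [[i k]|_ //] _ /=; rewrite /sigma_RV /preimage_set_system/=.
  case: insubP => [m _ _|_]; first by exists (B m) => //; rewrite setTI.
  by exists setT => //; rewrite setTI.
have := hindep JA.
have -> : \bigcap_(j in [set` J]) A j = C `&` [set w | forall m : 'I_n, B m (W (s m) m w)].
  apply/seteqP; split => [w H|w [Cw H] [[i k]|//]].
    split; first by apply: (H None); rewrite /= seq_fsetE mem_head.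
    move=> m; have := H (Some (s m, val m)); rewrite Am; apply.
    by rewrite /= seq_fsetE inE/= map_f// mem_enum.
  rewrite /= seq_fsetE inE/= => /mapP[m _ [-> ->]].
  by rewrite valK; exact: H.
move=> ->; rewrite (perm_big _ (seq_fset_perm tt r)) undup_id//= big_cons; congr (_ * _)%E.
by rewrite big_map big_enum/=; apply: eq_bigr => m _; rewrite valK.
Qed.

(* The product formula holds when every f m is an indicator, and as a function
   of a single f m both sides are integrals against a measure. *)
Lemma expectation_independent_sojourns (f : 'I_n -> R -> R) (phi : 'I_n -> R) :
  (forall m, measurable_fun setT (f m)) -> (forall m x, 0 <= f m x) ->
  (forall m, \int[P]_w (f m (W (s m) m w))%:E = (phi m)%:E)%E ->
  (\int[P]_w (\1_C w * \prod_(m < n) f m (W (s m) m w))%:E = (fine (P C) * \prod_(m < n) phi m)%:E)%E.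
Proof.
(* Induction on the number k of leading positions at which [f] is arbitrary; from position k on, the
   functions are indicators. *)
suff main k : (k <= n)%N -> forall (f : 'I_n -> R -> R) (phi : 'I_n -> R),
    (forall m, measurable_fun setT (f m)) -> (forall m x, 0 <= f m x) ->
    (forall m, \int[P]_w (f m (W (s m) m w))%:E = (phi m)%:E)%E ->
    (forall m : 'I_n, (k <= m)%N -> exists2 B, measurable B & f m = \1_B) ->
    (\int[P]_w (\1_C w * \prod_(m < n) f m (W (s m) m w))%:E = (fine (P C) * \prod_(m < n) phi m)%:E)%E.
  move=> mf f0 fphi; apply: (main n) => // m; by rewrite leqNgt ltn_ord.
elim: k => [|k IH] kn {}f {}phi mf f0 fphi find.
  have [B HB] := choice (fun m => let: ex_intro2 B mB fB := find m isT in
    ex_intro (fun B => measurable B /\ f m = \1_B) B (conj mB fB)).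
  have mB m : measurable (B m) by have [] := HB m.
  have fB m : f m = \1_(B m) by have [] := HB m.
  have PB (m : 'I_n) : P (W (s m) m @^-1` B m) = (phi m)%:E.
    by rewrite -fphi fB -[X in P X]setIT -integral_indic//; exact: mWB.
  pose E := C `&` [set w | forall m : 'I_n, B m (W (s m) m w)].
  have mE : measurable E.
    apply: measurableI => //.
    rewrite (_ : [set w | _] = \bigcap_(m : 'I_n) (W (s m) m @^-1` B m)).
      by apply: fin_bigcap_measurable => // m _; exact: mWB.
    by apply/seteqP; split => [w H m _|w H m]; exact: H.
  transitivity (\int[P]_w (\1_E w)%:E)%E.
    apply: eq_integral => w _; congr EFin; rewrite /E indicI; congr (_ * _).
    rewrite indicE; case: (boolP (w \in _)) => [/set_mem H|/negP H].
      by rewrite big1// => m _; rewrite fB indicE mem_set//; exact: H.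
    have [m Hm] : exists m : 'I_n, ~ B m (W (s m) m w).
      by apply/existsNP => H'; apply: H; exact/mem_set.
    by rewrite (bigD1 m)//= fB indicE memNset// mul0r.
  rewrite integral_indic// setIT; apply: (etrans (independent_sojourns_cap mB)).
  rewrite EFinM fineK ?fin_num_measure//.
  by congr (_ * _)%E; rewrite -prodEFin; apply: eq_bigr => m _; exact: PB.
pose m0 := Ordinal kn.
pose g w := \1_C w * \prod_(m < n | m != m0) f m (W (s m) m w).
pose c := fine (P C) * \prod_(m < n | m != m0) phi m.
have g0 w : 0 <= g w by rewrite mulr_ge0// prodr_ge0.
have mg : measurable_fun setT g.
  apply: measurable_funM; first exact: measurable_indic.
  under eq_fun do rewrite big_mkcond.
  apply: measurable_prod => m _; case: (m != m0) => //=.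
  exact: measurableT_comp.
transitivity (\int[P]_w ((f m0 (W (s m0) m0 w))%:E * (g w)%:E))%E.
  apply: eq_integral => w _; rewrite -EFinM; congr EFin.
  by rewrite (bigD1 m0)//= /g; ring.
rewrite (@integral_image_measure _ _ _ _ _ P (distribution P (W (s m0) m0)) c _ g (mW (s m0) m0) mg g0 _
  (fun x => (f m0 x)%:E))//.
- rewrite ge0_integral_distribution//; last 2 first.
    by apply/measurable_EFinP.
    by move=> x; rewrite lee_fin.
  rewrite fphi -EFinM (bigD1 m0)//=; congr EFin; rewrite /c; ring.
- move=> B mB.
  (* With an indicator at [m0] the family falls under the induction hypothesis; this yields the
     identity on sets that [integral_image_measure] extends to [f m0]. *)
  pose f' m := if m == m0 then \1_B else f m.
  pose phi' m := if m == m0 then fine (P (W (s m0) m0 @^-1` B)) else phi m.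
  have mB' := mWB (s m0) m0 mB.
  have h : (\int[P]_w (\1_C w * \prod_(m < n) f' m (W (s m) m w))%:E =
      (fine (P C) * \prod_(m < n) phi' m)%:E)%E.
    apply: IH (ltnW kn) _ _ _ _ _ _.
    - by move=> m; rewrite /f'; case: ifP.
    - by move=> m x; rewrite /f'; case: ifP.
    - move=> m; rewrite /f' /phi'; case: eqP => [->|_]; last exact: fphi.
      by rewrite fineK ?fin_num_measure// -[X in _ = P X]setIT -integral_indic.
    - move=> m km; rewrite /f'; case: eqP => [_|/eqP mm0]; first by exists B.
      by apply: find; rewrite ltn_neqAle km andbT; apply: contra mm0 => /eqP e; apply/eqP/val_inj.
  transitivity (\int[P]_w (\1_C w * \prod_(m < n) f' m (W (s m) m w))%:E)%E.
    rewrite integral_mkcond; apply: eq_integral => w _.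
    rewrite epatch_indic -EFinM; congr EFin; rewrite (bigD1 m0)//= {1}/f' eqxx /g.
    rewrite [X in _ = _ * (_ * X)](eq_bigr (fun m : 'I_n => f m (W (s m) m w))); last first.
      by move=> m mm0; rewrite /f' (negbTE mm0).
    by rewrite mulrAC -mulrA.
  rewrite h (bigD1 m0)//= {1}/phi' eqxx.
  rewrite [X in (_ * (_ * X))%:E](eq_bigr phi); last by move=> m mm0; rewrite /phi' (negbTE mm0).
  by rewrite mulrCA mulrC EFinM fineK ?fin_num_measure.
- by apply/measurable_EFinP.
- by move=> x; rewrite lee_fin.
Qed.
End independence.

Lemma measurable_fun_finite_case d d' (S : measurableType d) (V : measurableType d')
    q (Z : S -> 'I_q) (F : 'I_q -> S -> V) :
  (forall i, measurable (Z @^-1` [set i])) -> (forall i, measurable_fun setT (F i)) ->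
  measurable_fun setT (fun x => F (Z x) x).
Proof.
move=> mZ mF _ B mB; rewrite setTI.
rewrite (_ : _ @^-1` B = \bigcup_(i : 'I_q) (Z @^-1` [set i] `&` F i @^-1` B)).
  apply: fin_bigcup_measurable => // i _; apply: measurableI => //.
  by rewrite -[_ @^-1` _]setTI; exact: mF.
by apply/seteqP; split => [x Bx|x [i _ [/= <-]]//]; exists (Z x).
Qed.

Section path_events.
Context {Omega : Type} {p : nat} (Y : nat -> Omega -> 'I_(p + 1)).

(** The last state [j] is kept apart because it may be absorbing. [s] is total on nat, so that a
    prefix can be lengthened by one state without a change of type. *)
Definition path_event (n : nat) (s : nat -> 'I_p) (j : 'I_(p + 1)) : set Omega :=
  [set w | (forall m, (m < n)%N -> Y m w = lshift 1 (s m)) /\ Y n w = j].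

(** The offset [n] lets the induction move one step from the remaining path to the prefix while n +
    k stays fixed. *)
Definition absorbed_after (n k : nat) : set Omega :=
  [set w | (forall m, (m < k)%N -> Y (n + m) w <> absorbing p) /\ Y (n + k) w = absorbing p].

End path_events.

Section paths.
Context {d} {Omega : measurableType d} {R : realType} (P : probability Omega R).
Context {p : nat} (Y : nat -> Omega -> 'I_(p + 1)) (W : 'I_p -> nat -> {RV P >-> R}).
Hypothesis hindep : mutually_independent P (sojourn_chain_sigma W Y).
Variable Q : 'M[R]_(p + 1).
Hypothesis hY : markov_chain P Q Y.

Let mY n i : measurable (Y n @^-1` [set i]).
Proof. by case: hY. Qed.

Let path_eventE n s j : path_event Y n s j =
  \bigcap_(m : 'I_n.+1) (Y m @^-1` [set (if (m < n)%N then lshift 1 (s m) else j)]).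
Proof.
apply/seteqP; split => [w [H1 H2] m _ /=|w H].
  case: ifPn => mn; first exact: H1.
  by rewrite (_ : m = n :> nat)//; apply/eqP; rewrite eqn_leq -ltnS ltn_ord leqNgt.
split => [m mn|]; last by have := H ord_max I; rewrite /= ltnn.
by have := H (widen_ord (leqnSn n) (Ordinal mn)) I; rewrite /= mn.
Qed.

Lemma measurable_path_event n s j : measurable (path_event Y n s j).
Proof. by rewrite path_eventE; apply: fin_bigcap_measurable => // m _; exact: mY. Qed.

Lemma sigma_chain_path_event n s j : sigma_chain Y (path_event Y n s j).
Proof.
rewrite path_eventE /sigma_chain; set G := [set A | _].
apply: (@fin_bigcap_measurable _ (g_sigma_algebraType G)) => // m _.
by apply: sub_sigma_algebra; exists m, [set (if (m < n)%N then lshift 1 (s m) else j)].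
Qed.

Lemma measurable_absorbed_after n k : measurable (absorbed_after Y n k).
Proof.
rewrite (_ : absorbed_after Y n k = \bigcap_(m : 'I_k) ~` (Y (n + m) @^-1` [set absorbing p])
    `&` Y (n + k) @^-1` [set absorbing p]).
  apply: measurableI => //.
  by apply: fin_bigcap_measurable => // m _; exact: measurableC.
apply/seteqP; split => [w [H1 H2]|w [H1 H2]]; split => // m; first by move=> _; exact: H1.
by move=> mk; exact: (H1 (Ordinal mk)).
Qed.

Lemma path_event_markov n s i l :
  P (path_event Y n.+1 (fun m => if m == n then i else s m) l) =
  (P (path_event Y n s (lshift 1 i)) * (Q (lshift 1 i) l)%:E)%E.
Proof.
pose r m := if (m < n)%N then lshift 1 (s m) else if m == n then lshift 1 i else l.
have rn : r n = lshift 1 i by rewrite /r ltnn eqxx.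
have rn1 : r n.+1 = l by rewrite /r ltnNge leqnSn/= gtn_eqF.
have -> : path_event Y n.+1 (fun m => if m == n then i else s m) l =
    [set w | forall k, (k <= n.+1)%N -> Y k w = r k].
  apply/seteqP; split => [w [H1 H2] k|w H].
    rewrite leq_eqVlt => /predU1P[->|kn]; first by rewrite rn1.
    rewrite H1// /r; case: eqP => [->|/eqP kn']; first by rewrite ltnn.
    by rewrite ltn_neqAle kn' -ltnS kn.
  split; last by rewrite H.
  move=> m mn; rewrite (H _ (ltnW mn)) /r; case: eqP => [->|/eqP mn']; first by rewrite ltnn.
  by rewrite ltn_neqAle mn' -ltnS mn.
have -> : path_event Y n s (lshift 1 i) = [set w | forall k, (k <= n)%N -> Y k w = r k].
  apply/seteqP; split => [w [H1 H2] k|w H].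
    rewrite leq_eqVlt => /predU1P[->|kn]; first by rewrite rn.
    by rewrite H1// /r kn.
  split; last by rewrite H.
  by move=> m mn; rewrite (H _ (ltnW mn)) /r mn.
by have [_ ->] := hY; rewrite rn rn1.
Qed.

Variables (h : R -> R) (phi : 'I_p -> R).
Hypotheses (mh : measurable_fun setT h) (h0 : forall x, 0 <= h x).
Hypothesis hphi : forall i k, (\int[P]_w (h (W i k w))%:E = (phi i)%:E)%E.

Definition sojourn_factor (j : 'I_(p + 1)) (m : nat) (w : Omega) : R :=
  if fintype.split j is inl i then h (W i m w) else 1.

(* Sum, over the paths of the chain from j that are absorbed at step k exactly,
   of the path probability times the product of phi along the path. *)
Fixpoint absorption_weight (k : nat) (j : 'I_(p + 1)) : R :=
  if k is k'.+1 then
    if fintype.split j is inl i then phi i * \sum_l Q j l * absorption_weight k' l else 0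
  else (j == absorbing p)%:R.

Let split_lshift i : fintype.split (lshift 1 i : 'I_(p + 1)) = inl i.
Proof. exact: (unsplitK (inl i)). Qed.

Let split_absorbing : fintype.split (absorbing p) = inr ord0.
Proof. exact: (unsplitK (inr ord0)). Qed.

Let sojourn_factor_ge0 j m w : 0 <= sojourn_factor j m w.
Proof. by rewrite /sojourn_factor; case: fintype.split. Qed.

Let integrand n k w := \prod_(m < n + k) sojourn_factor (Y m w) m w.

Let integrand_ge0 n k w : 0 <= integrand n k w.
Proof. by rewrite prodr_ge0. Qed.

Let measurable_integrand n k : measurable_fun setT (integrand n k).
Proof.
apply: measurable_prod => m _.
apply: (@measurable_fun_finite_case _ _ _ _ _ (Y m) (fun j => sojourn_factor j m)) => // j.
by rewrite /sojourn_factor; case: fintype.split => // i; exact: measurableT_comp.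
Qed.

(** Induction on [k], for all prefixes at once: the event is split according to the state at time n
    + 1, which makes the prefix one step longer, and the Markov property supplies the factor [Q]. At
    k = 0 the whole path is prescribed and independence factorizes the expectation. *)
Lemma hitting_expectation k n s j :
  (\int[P]_w (\1_(path_event Y n s j `&` absorbed_after Y n k) w *
      \prod_(m < n + k) sojourn_factor (Y m w) m w)%:E =
   (fine (P (path_event Y n s j)) * (\prod_(m < n) phi (s m) * absorption_weight k j))%:E)%E.
Proof.
elim: k n s j => [|k IH] n s j.
  case: (eqVneq j (absorbing p)) => [->|ja] /=; last first.
    rewrite (negbTE ja) !mulr0; apply: integral0_eq => w _.
    rewrite indicE memNset ?mul0r// => -[[_ /= Yn] [_]]; rewrite addn0 Yn.
    by move=> e; rewrite e eqxx in ja.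
  rewrite eqxx mulr1.
  rewrite -(@expectation_independent_sojourns _ _ _ _ _ _ _ hindep n s _
    (measurable_path_event _ _ _) (sigma_chain_path_event _ _ _) (fun=> h) (fun m => phi (s m)))//.
  apply: eq_integral => w _; congr EFin; rewrite !indicE addn0.
  have [/set_mem wC|wC] := boolP (w \in path_event Y n s (absorbing p)); last first.
    rewrite mul0r memNset ?mul0r// => -[/mem_set wC' _].
    by rewrite wC' in wC.
  rewrite mem_set; last by split => //; split => //; rewrite addn0; case: wC.
  congr (_ * _); apply: eq_bigr => m _; rewrite /sojourn_factor.
  by case: wC => /(_ _ (ltn_ord m)) -> _; rewrite split_lshift.
case: (fintype.splitP j) => [i ji|o jo]; last first.
  have -> : j = absorbing p by apply: val_inj; rewrite /= jo (ord1 o).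
  rewrite /= split_absorbing !mulr0; apply: integral0_eq => w _.
  by rewrite indicE memNset ?mul0r// => -[[_ /= Yn] [/(_ 0%N isT)]]; rewrite addn0 Yn.
have {j ji} -> : j = lshift 1 i by apply: val_inj.
pose s' m := if m == n then i else s m.
transitivity (\int[P]_w (\sum_(l < p + 1) (\1_(path_event Y n.+1 s' l `&` absorbed_after Y n.+1 k) w *
      integrand n.+1 k w)%:E))%E.
  apply: eq_integral => w _; rewrite sumEFin; congr EFin.
  rewrite -big_distrl/= /integrand addSnnS; congr (_ * _).
  rewrite (bigD1 (Y n.+1 w))//= big1 ?addr0; last first.
    move=> l lY; rewrite indicE memNset// => -[[_ /= e]].
    by rewrite e eqxx in lY.
  rewrite !indicE; congr (_%:R); congr nat_of_bool; apply/idP/idP.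
  - move=> /set_mem [[H1 H2] [H3 H4]]; apply/mem_set; split; split => //.
    + move=> m; rewrite ltnS leq_eqVlt /s' => /predU1P[->|mn]; first by rewrite eqxx.
      by rewrite ltn_eqF// H1.
    + by move=> m mk; rewrite addSnnS; exact: H3.
    + by rewrite addSnnS.
  - move=> /set_mem [[H1 _] [H3 H4]]; apply/mem_set.
    have Yn : Y n w = lshift 1 i by have := H1 n (leqnn _); rewrite /s' eqxx.
    split; split => //.
    + by move=> m mn; rewrite (H1 _ (ltnW mn)) /s' ltn_eqF.
    + case=> [_|m mk]; last by rewrite -(addSnnS n m); exact: H3.
      by rewrite addn0 Yn => /(congr1 fintype.split); rewrite split_lshift split_absorbing.
    + by rewrite -(addSnnS n k).
rewrite ge0_integral_sum//; last 2 first.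
- move=> l; apply/measurable_EFinP; apply: measurable_funM => //; apply: measurable_indic.
  by apply: measurableI; [exact: measurable_path_event|exact: measurable_absorbed_after].
- by move=> l w _; rewrite lee_fin mulr_ge0.
under eq_bigr do rewrite IH.
rewrite sumEFin /= split_lshift; congr EFin.
rewrite !big_distrr/=; apply: eq_bigr => l _.
rewrite /s' path_event_markov fineM ?fin_num_measure//=; last exact: measurable_path_event.
rewrite big_ord_recr/= eqxx (eq_bigr (fun m : 'I_n => phi (s m))); first by ring.
by move=> m _; rewrite ltn_eqF.
Qed.
End paths.

(** * The absorption time *)

Section absorption.
Context {Omega : Type} {R : realType} {p : nat}.
Variables (W : 'I_p -> nat -> Omega -> R) (Y : nat -> Omega -> 'I_(p + 1)).
Local Notation S := (jump_time W Y).

Lemma semi_markovP (t : R) w j : semi_markov W Y t w = Some j <->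
  exists n, [/\ (S n w <= t%:E < S n.+1 w)%E,
    forall m, (m < n)%N -> ~~ (S m w <= t%:E < S m.+1 w)%E & Y n w = j].
Proof.
rewrite /semi_markov; case: pselect => [H|H]; last first.
  by split => // -[n [Hn _ _]]; exfalso; apply: H; exists n.
case: ex_minnP => n Hn nmin; split => [[<-]|[m [Hm mmin <-]]].
  exists n; split => // m mn; apply/negP => /nmin; by rewrite leqNgt mn.
congr (Some (Y _ w)); apply/eqP; rewrite eqn_leq nmin// leqNgt.
by apply/negP => /mmin; rewrite Hn.
Qed.

(* Lets absorption_time be computed as an infimum over rational times, hence
   measurably, also on the null event where some sojourn time is negative. *)
Lemma semi_markov_right_open (t : R) w j : semi_markov W Y t w = Some j ->
  exists2 c : \bar R, (t%:E < c)%E &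
    forall t' : R, t <= t' -> (t'%:E < c)%E -> semi_markov W Y t' w = Some j.
Proof.
move=> /semi_markovP[n [/andP[Sn Sn1] nmin Yn]].
(* Jump times need not increase here, so an interval of smaller index could begin after [t] and take
   over. [c] is chosen so that none of them begins strictly between [t] and [c]. *)
have [c tc Hc] : exists2 c : \bar R, (t%:E < c)%E &
    forall m, (m < n)%N -> (t%:E < S m w)%E -> (c <= S m w)%E.
  move: {Sn Sn1 nmin Yn} n; elim=> [|n [c tc IH]]; first by exists +oo%E; rewrite ?ltry.
  have [tS|St] := ltP t%:E (S n w).
    exists (Order.min c (S n w)); first by rewrite lt_min tc.
    move=> m; rewrite ltnS leq_eqVlt => /predU1P[->|mn] tSm; first by rewrite ge_min lexx orbT.
    by rewrite ge_min IH.
  exists c => // m; rewrite ltnS leq_eqVlt => /predU1P[->|]; last exact: IH.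
  by rewrite ltNge St.
exists (Order.min c (S n.+1 w)); first by rewrite lt_min tc.
move=> t' tt'; rewrite lt_min => /andP[t'c t'S]; apply/semi_markovP; exists n; split => //.
  by rewrite t'S andbT (le_trans Sn)// lee_fin.
move=> m mn; have := nmin _ mn; rewrite !negb_and -!ltNge -!leNgt => /orP[tS|St].
  by rewrite (lt_le_trans t'c)// Hc.
by rewrite (le_trans St) ?lee_fin// orbT.
Qed.

Section path.
Variables (w : Omega) (k : nat).
Hypotheses (wk : absorbed_after Y 0 k w) (W0 : forall i n, 0 <= W i n w).

Let split_absorbing : fintype.split (absorbing p) = inr ord0.
Proof. exact: (unsplitK (inr ord0)). Qed.

Let sojourn_ge0 j n : (0 <= sojourn W j n w)%E.
Proof. by rewrite /sojourn; case: fintype.split => // i; rewrite lee_fin. Qed.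

Let S_nd m n : (m <= n)%N -> (S m w <= S n w)%E.
Proof.
move=> /subnK <-; elim: (n - m)%N => [|l IH]; first by rewrite add0n.
by apply: (le_trans IH); rewrite addSn /jump_time big_ord_recr/= leeDl.
Qed.

Lemma jump_time_absorbed :
  S k w = (\sum_(m < k) fine (sojourn W (Y m w) m w))%:E.
Proof.
rewrite -sumEFin; apply: eq_bigr => m _; rewrite fineK//.
have [/(_ _ (ltn_ord m))] := wk; rewrite add0n /sojourn => Ym _.
case: (fintype.splitP (Y m w)) => // o Yo; exfalso; apply: Ym; apply: val_inj.
by rewrite /= Yo (ord1 o).
Qed.

Let S_k1 : S k.+1 w = +oo%E.
Proof.
rewrite /jump_time big_ord_recr/=; have [_ ->] := wk.
rewrite [X in (_ + X)%E](_ : _ = +oo%E); last by rewrite /sojourn split_absorbing.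
rewrite addey// -ltNye.
by apply: (@lt_le_trans _ _ 0%E) => //; exact: sume_ge0.
Qed.

Lemma semi_markov_absorbed (t : R) :
  semi_markov W Y t w = Some (absorbing p) <-> (S k w <= t%:E)%E.
Proof.
split => [/semi_markovP[n [/andP[Sn _] _ Yn]]|St].
  apply: le_trans Sn; apply: S_nd; rewrite leqNgt; apply/negP => nk.
  by have [/(_ _ nk)] := wk; rewrite add0n Yn.
apply/semi_markovP; exists k; split; last by case: wk.
  by rewrite St S_k1 ltry.
move=> m mk; rewrite negb_and orbC -leNgt; apply/orP; left.
by apply: le_trans St; exact: S_nd.
Qed.

Lemma absorption_time_absorbed : absorption_time W Y w = S k w.
Proof.
apply/eqP; rewrite eq_le; apply/andP; split.
  apply: ereal_inf_lbound; exists (\sum_(m < k) fine (sojourn W (Y m w) m w)).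
    split; first by apply: sumr_ge0 => m _; exact: fine_ge0.
    by apply/semi_markov_absorbed; rewrite jump_time_absorbed.
  by rewrite jump_time_absorbed.
by apply: le_ereal_inf_tmp => _ [t [_ /semi_markov_absorbed St] <-].
Qed.
End path.
End absorption.

Section absorption_time_measurable.
Context {d} {Omega : measurableType d} {R : realType} {p : nat}.
Variables (W : 'I_p -> nat -> Omega -> R) (Y : nat -> Omega -> 'I_(p + 1)).
Hypotheses (mW : forall i n, measurable_fun setT (W i n)).
Hypotheses (mY : forall n i, measurable (Y n @^-1` [set i])).

Lemma measurable_jump_time n : measurable_fun setT (jump_time W Y n).
Proof.
apply: emeasurable_sum => m.
apply: (@measurable_fun_finite_case _ _ _ _ _ (Y m) (fun j => sojourn W j m)) => // j.
by rewrite /sojourn; case: fintype.split => // i; apply/measurable_EFinP; exact: mW.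
Qed.

Let mI (t : R) n : measurable [set w | (jump_time W Y n w <= t%:E < jump_time W Y n.+1 w)%E].
Proof.
rewrite (_ : [set w | _] = [set w | (jump_time W Y n w <= t%:E)%E] `&`
   [set w | (t%:E < jump_time W Y n.+1 w)%E]); last first.
  by apply/seteqP; split => w /=; [move=> /andP|move=> [-> ->]].
apply: measurableI; rewrite -[X in measurable X]setTI.
- exact: measurable_lee (measurable_jump_time n) (measurable_cst _).
- exact: measurable_lte (measurable_cst _) (measurable_jump_time n.+1).
Qed.

Lemma measurable_semi_markov (t : R) j : measurable [set w | semi_markov W Y t w = Some j].
Proof.
rewrite (_ : [set w | _] = \bigcup_n
  ([set w | (jump_time W Y n w <= t%:E < jump_time W Y n.+1 w)%E] `&`
   \bigcap_(m : 'I_n) ~` [set w | (jump_time W Y m w <= t%:E < jump_time W Y m.+1 w)%E] `&`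
   Y n @^-1` [set j])).
  apply: bigcup_measurable => n _; apply: measurableI => //; apply: measurableI => //.
  by apply: fin_bigcap_measurable => // m _; exact: measurableC.
apply/seteqP; split => [w /semi_markovP[n [H1 H2 H3]]|w [n _ [[H1 H2] H3]]].
  by exists n => //; split => //; split => // m _ /=; exact/negP/H2.
apply/semi_markovP; exists n; split => // m mn; apply/negP.
exact: (H2 (Ordinal mn)).
Qed.

Lemma measurable_absorption_time : measurable_fun setT (absorption_time W Y).
Proof.
(* An enumeration of the nonnegative rational times spent in the absorbing state; the default value
   +oo does not affect the infimum. *)
pose f (n : nat) (w : Omega) : \bar R :=
  if (choice.unpickle n : option rat) is Some q then
    if (0 <= q) && `[< semi_markov W Y (ratr q) w = Some (absorbing p) >]
    then (ratr q)%:E else +oo%E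
  else +oo%E.
have mf n : measurable_fun setT (f n).
  rewrite /f; case: choice.unpickle => [q|//].
  case: (0 <= q) => //=; apply: measurable_fun_ifT => //.
  apply: (measurable_fun_bool true); rewrite setTI.
  rewrite (_ : _ @^-1` _ = [set w | semi_markov W Y (ratr q) w = Some (absorbing p)]).
    exact: measurable_semi_markov.
  by apply/seteqP; split => w /= /asboolP.
rewrite (_ : absorption_time W Y = fun w => einfs (f ^~ w) 0%N).
  exact: measurable_fun_einfs.
apply/funext => w; rewrite /einfs; apply/eqP; rewrite eq_le; apply/andP; split.
  apply: le_ereal_inf_tmp => _ [n _ <-]; rewrite /f.
  case: choice.unpickle => [q|]; last exact: leey.
  case: ifPn => [/andP[q0 /asboolP Hq]|_]; last exact: leey.
  by apply: ereal_inf_lbound; exists (ratr q) => //; split => //; rewrite ler0q.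
apply: le_ereal_inf_tmp => _ [t [t0 Ht] <-].
have [c tc Hc] := semi_markov_right_open Ht.
apply/lee_addgt0Pr => e e0.
(* [c] may be infinite, so a real bound is extracted first; any rational between [t] and [b] is an
   absorbed time within [e] of [t]. *)
have [b tb bc] : exists2 b : R, t < b & (b%:E <= Order.min c (t + e)%:E)%E.
  have te : t < t + e by rewrite ltrDl.
  case: c tc {Hc} => [c| |] // tc.
    exists (Num.min c (t + e)); first by rewrite lt_min te andbT -lte_fin.
    by rewrite EFin_min.
  by exists (t + e) => //; rewrite min_r// leey.
have [q] := rat_in_itvoo tb; rewrite in_itv/= => /andP[tq qb].
apply: (@le_trans _ _ (ratr q)%:E); last first.
  by rewrite -EFinD lee_fin; move: bc; rewrite le_min !lee_fin => /andP[_ /(le_trans (ltW qb))].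
have Hq : semi_markov W Y (ratr q) w = Some (absorbing p).
  apply: Hc; first exact: ltW.
  by apply: (@lt_le_trans _ _ b%:E); [rewrite lte_fin|move: bc; rewrite le_min => /andP[]].
apply: ereal_inf_lbound; exists (choice.pickle q) => //.
rewrite /f choice.pickleK; have q0 : 0 <= q by rewrite -(ler0q R) (le_trans t0)// ltW.
by rewrite q0 /=; case: asboolP.
Qed.
End absorption_time_measurable.

(** * The resolvent of T and the sum over absorbed paths *)

Section generator.
Context {R : realType} {p : nat} (Q1 : 'M[R]_p) (q1 : 'cV[R]_p) (Q : 'M[R]_(p + 1)).
Hypothesis hQ : Q = block_mx Q1 q1 0 1%:M.
Hypothesis hQ_stoch : stochastic Q.
Hypothesis hQ_diag : forall i, Q1 i i = 0.
Hypothesis hQ_trans : forall i : 'I_p, transient Q (lshift 1 i).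
Variables (lam : 'I_p -> R) (T : 'M[R]_p) (t : 'cV[R]_p).
Hypothesis hlam : forall i, 0 < lam i.
Hypothesis hLambda : intensity_matrix lam Q = block_mx T t 0 0.

Lemma transient_block_exprmx_cvg0 i j : (Q1 ^+ n) i j @[n --> \oo] --> 0.
Proof.
have := transient_exprmx_cvg0 hQ_stoch (lshift 1 i) (hQ_trans j).
rewrite (_ : (fun n => (Q ^+ n) _ _) = (fun n => (Q1 ^+ n) i j))//; apply/funext => n.
by have [v E] := expr_block_mx Q1 q1 n; rewrite hQ E block_mxEul.
Qed.

Let Q1_ge0 i j : 0 <= Q1 i j.
Proof. by have [+ _] := hQ_stoch => /(_ (lshift 1 i) (lshift 1 j)); rewrite hQ block_mxEul. Qed.

Lemma exit_probE i : \sum_j Q1 i j + q1 i 0 = 1.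
Proof.
have [_ /(_ (lshift 1 i)) <-] := hQ_stoch; rewrite big_split_ord/= big_ord1; congr (_ + _).
  by apply: eq_bigr => j _; rewrite hQ block_mxEul.
by rewrite hQ block_mxEur.
Qed.

Lemma generatorE i j : T i j = lam i * (Q1 i j - (i == j)%:R).
Proof.
have := congr1 (fun M : 'M[R]_(p + 1) => M (lshift 1 i) (lshift 1 j)) hLambda.
rewrite block_mxEul mxE => <-.
have -> : ext_rate lam (lshift 1 i) = lam i.
  by rewrite /ext_rate (unsplitK (inl i : 'I_p + 'I_1)).
rewrite (inj_eq (@lshift_inj _ _)); case: eqP => [<-|_].
  by rewrite hQ_diag sub0r mulrN1.
by rewrite subr0 hQ block_mxEul.
Qed.

Lemma exit_rateE i : (- (T *m ones p)) i 0 = lam i * q1 i 0.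
Proof.
rewrite 2!mxE; set q := \sum_j Q1 i j.
have S : \sum_j (i == j)%:R = 1 :> R.
  rewrite (bigD1 i)//= eqxx big1 ?addr0// => j ji.
  by rewrite eq_sym (negbTE ji).
have -> : \sum_j T i j * ones p j 0 = lam i * (q - 1).
  rewrite -S -sumrB big_distrr/=; apply: eq_bigr => j _.
  by rewrite generatorE [ones _ _ _]mxE mulr1.
have -> : q1 i 0 = 1 - q by rewrite -(exit_probE i) addrAC subrr add0r.
by ring.
Qed.

Variables (v : R) (v0 : 0 <= v).
Let phi i := lam i / (v + lam i).
Let vl i : 0 < v + lam i. Proof. exact: ltr_wpDl. Qed.
Let A : 'M[R]_p := \matrix_(i, j) (phi i * Q1 i j).
Let r : 'cV[R]_p := \col_i (phi i * q1 i 0).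

Let A_cvg0 i j : (A ^+ n) i j @[n --> \oo] --> 0.
Proof.
have AQ k l : 0 <= A k l <= Q1 k l.
  rewrite mxE mulr_ge0 ?divr_ge0// ?(ltW (hlam k)) ?(ltW (vl k))//=.
  by rewrite ler_piMl// ler_pdivrMr// mul1r lerDr.
apply: (squeeze_cvgr _ (cvg_cst 0) (transient_block_exprmx_cvg0 i j)).
by apply: nearW => n; exact: le_exprmx.
Qed.

(** Taking out the positive diagonal reduces invertibility of the resolvent to that of 1 - A,
    including at v = 0. *)
Let resolventE : v%:M - T = diag_mx (\row_i (v + lam i)) *m (1%:M - A).
Proof.
apply/matrixP => i j; rewrite mul_diag_mx !mxE generatorE /phi.
by case: eqP => [->|_] /=; field; rewrite gt_eqF.
Qed.

Lemma resolvent_unitmx : v%:M - T \in unitmx.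
Proof.
rewrite resolventE unitmx_mul unitmx_1B ?andbT; last exact: A_cvg0.
rewrite unitmxE det_diag unitfE; apply/prodf_neq0 => i _.
by rewrite mxE gt_eqF.
Qed.

Let y := invmx (v%:M - T) *m (- (T *m ones p)).

(** The first-step equation for the transform of the absorption time from each state: [r] accounts
    for an immediate exit and [A] for a move to another transient state. It is (v - T) y = - T e
    with row i divided by v + lam i. *)
Let y_fix : y = r + A *m y.
Proof.
have E : (v%:M - T) *m y = - (T *m ones p) by rewrite mulKVmx// resolvent_unitmx.
apply/colP => i; have := congr1 (fun M : 'cV[R]_p => M i 0) E.
rewrite exit_rateE resolventE -mulmxA mul_diag_mx mxE mulmxBl mul1mx.
rewrite [(y - A *m y) i 0]mxE [(- (A *m y)) i 0]mxE [(\row_i0 _) 0 i]mxE => H.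
have nz : v + lam i != 0 by rewrite gt_eqF.
rewrite [RHS]mxE [r i 0]mxE; apply: (mulfI nz); rewrite mulrDr.
rewrite [X in _ = X + _](_ : _ = lam i * q1 i 0); last by rewrite /phi; field.
by rewrite -H; ring.
Qed.

Lemma absorption_weight_lshift k i :
  absorption_weight Q phi k.+1 (lshift 1 i) = (A ^+ k *m r) i 0.
Proof.
have sl j : fintype.split (lshift 1 j : 'I_(p + 1)) = inl j by exact: (unsplitK (inl j)).
have sa : fintype.split (rshift p ord0 : 'I_(p + 1)) = inr ord0 by exact: (unsplitK (inr ord0)).
elim: k i => [|k IH] i /=.
  rewrite expr0 mul1mx sl [RHS]mxE; congr (_ * _).
  rewrite big_split_ord/= big_ord1 big1 ?add0r; last first.
    move=> j _; rewrite [_ == _](_ : _ = false) ?mulr0//; apply/negbTE/eqP.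
    by move=> /(congr1 fintype.split); rewrite sl sa.
  by rewrite eqxx mulr1 hQ block_mxEur.
rewrite sl big_split_ord/= big_ord1/= sa mulr0 addr0.
rewrite exprS -[A * _]/(A *m _) -mulmxA [RHS]mxE big_distrr/=.
apply: eq_bigr => j _; have /= -> := IH j.
by rewrite hQ block_mxEul [A i j]mxE mulrA.
Qed.

Lemma absorption_weight_sum (pi : 'rV[R]_p) :
  (\sum_(0 <= k < n) \sum_i pi 0 i * absorption_weight Q phi k (lshift 1 i)) @[n --> \oo] -->
  (pi *m y) 0 0.
Proof.
(* From a transient state the weight at k = 0 vanishes, so the matrix series starts with absorption
   at step 1. *)
rewrite -cvg_shiftS /=.
have E n : \sum_(0 <= k < n.+1) \sum_i pi 0 i * absorption_weight Q phi k (lshift 1 i) =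
    \sum_i pi 0 i * \sum_(0 <= k < n) (A ^+ k *m r) i 0.
  rewrite big_nat_recl//= big1 ?add0r; last first.
    move=> i _; rewrite [_ == _](_ : _ = false) ?mulr0//; apply/negbTE/eqP.
    move=> /(congr1 fintype.split).
    by rewrite (unsplitK (inl i : 'I_p + 'I_1)) (unsplitK (inr ord0 : 'I_p + 'I_1)).
  rewrite exchange_big; apply: eq_bigr => i _; rewrite big_distrr/=.
  by apply: eq_bigr => k _; rewrite -absorption_weight_lshift.
under eq_fun do rewrite E.
rewrite mxE; apply: cvg_big => [|i _]; first exact: add_continuous.
by apply: cvgMr; apply: geometric_mx_cvg; [exact: A_cvg0|exact: y_fix].
Qed.
End generator.

(** * The matrix Mittag-Leffler function *)

Lemma cvg_mx_coord {R : realType} {m n : nat} (u : nat -> 'M[R]_(m, n)) (M : 'M[R]_(m, n)) :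
  (forall i j, u k i j @[k --> \oo] --> M i j) -> u @ \oo --> M.
Proof.
move=> uM A [B MB BA].
have : \forall k \near \oo, forall i j, B i j (u k i j).
  by apply: filter_forall => i; apply: filter_forall => j; exact: uM.
by apply: filterS => k Bk; exact: BA.
Qed.

Section entire_series.
Context {R : realType}.

(* The geometric factor makes the property stable under pseries_diffs. *)
Definition rapid_decay (f : nat -> R) :=
  forall z : R, 0 <= z -> exists D, forall k, `|f k| * z ^+ k <= D * 2^-1 ^+ k.

Lemma rapid_decay_cvg f z : rapid_decay f -> cvgn (pseries f z).
Proof.
move=> /(_ `|z| (normr_ge0 z))[D HD]; apply: normed_cvg.
have D0 : 0 <= D.
  by have := HD 0%N; rewrite !expr0 !mulr1; exact: le_trans.
apply: (@series_le_cvg _ _ (geometric D 2^-1)).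
- by move=> n /=.
- by move=> n /=; rewrite mulr_ge0// exprn_ge0.
- by move=> n; rewrite /= normrM normrX.
- by apply: is_cvg_geometric_series; rewrite ger0_norm// invf_lt1// ltr1n.
Qed.

Lemma rapid_decay_diffs f : rapid_decay f -> rapid_decay (pseries_diffs f).
Proof.
(* The factor k + 1 from differentiation is absorbed by 2^(k+1); using z + 1 >= 1 in place of z pays
   for the shift of the exponent from k to k + 1. *)
move=> rf z z0; have z1 : 0 <= 2 * (z + 1) by rewrite mulr_ge0// addr_ge0.
have [D HD] := rf _ z1; exists D => k.
have D0 : 0 <= D by have := HD 0%N; rewrite !expr0 !mulr1; exact: le_trans.
apply: (@le_trans _ _ (D * 2^-1 ^+ k.+1)); last first.
  by rewrite ler_wpM2l// exprS ler_piMl ?exprn_ge0// invf_le1// ler1n.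
apply: le_trans (HD k.+1); rewrite /pseries_diffs normrM normr_nat mulrC mulrA.
rewrite mulrC ler_wpM2l// exprMn mulrC ler_pM ?exprn_ge0//.
  by rewrite -natrX ler_nat; exact/ltnW/ltn_expl.
apply: (@le_trans _ _ ((z + 1) ^+ k)).
  by rewrite lerXn2r ?nnegrE ?addr_ge0// lerDl.
by rewrite exprS ler_peMl ?exprn_ge0 ?addr_ge0// lerDr.
Qed.

(** Continuity is deduced from termwise differentiability, for which the series and its first two
    derived series must converge at a radius exceeding |x|, here |x| + 1. *)
Lemma rapid_decay_continuous f : rapid_decay f -> continuous (fun z => limn (pseries f z)).
Proof.
move=> rf x.
have := @pseries_snd_diffs R f (`|x| + 1) x (@rapid_decay_cvg f _ rf)
  (@rapid_decay_cvg _ _ (rapid_decay_diffs rf))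
  (@rapid_decay_cvg _ _ (rapid_decay_diffs (rapid_decay_diffs rf))).
rewrite [ltRHS]ger0_norm ?addr_ge0// ltrDl ltr01 => /(_ isT) [df _].
by apply: differentiable_continuous; exact/derivable1_diffP.
Qed.
End entire_series.

Section matrix_ML.
Context {R : realType} {p : nat} (a : R) (pi : 'rV[R]_p) (T : 'M[R]_p).
Hypothesis a0 : 0 < a.

(** The double sum dominates every row sum of |T|, which gives the geometric bound on powers; the
    summand 1 keeps the rate positive when T = 0. *)
Definition exprmx_rate : R := 1 + \sum_i \sum_j `|T i j|.
Local Notation K := exprmx_rate.

Lemma exprmx_rate_gt0 : 0 < K.
Proof. by rewrite ltr_wpDr// sumr_ge0// => i _; rewrite sumr_ge0. Qed.

Lemma exprmx_bound n i j : `|(T ^+ n) i j| <= K ^+ n.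
Proof.
elim: n i j => [|n IH] i j.
  by rewrite !expr0 mxE; case: eqP; rewrite ?normr1// normr0.
rewrite exprmxS (le_trans (ler_norm_sum _ _ _))//.
apply: (@le_trans _ _ (\sum_l `|T i l| * K ^+ n)).
  by apply: ler_sum => l _; rewrite normrM ler_wpM2l.
rewrite -big_distrl/= exprS ler_wpM2r// ?exprn_ge0 ?(ltW exprmx_rate_gt0)//.
rewrite /K [X in _ <= _ + X](bigD1 i)//= addrCA lerDl addr_ge0// sumr_ge0// => l _.
by rewrite sumr_ge0.
Qed.

(** Pairing with [pi] and the vector of ones turns the matrix series into a scalar one, to which the
    estimates for Mittag-Leffler series apply. *)
Definition ML_mx_coef (k : nat) : R := (pi *m T ^+ k *m ones p) 0 0.
Local Notation c := ML_mx_coef.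

Lemma ML_mx_coefE k : c k = \sum_j \sum_i pi 0 i * (T ^+ k) i j.
Proof.
rewrite /c mxE; apply: eq_bigr => j _; rewrite [ones p j 0]mxE mulr1.
by rewrite mxE.
Qed.

Lemma ML_mx_coef_bound k : `|c k| <= (\sum_(j < p) \sum_i `|pi 0 i|) * K ^+ k.
Proof.
rewrite ML_mx_coefE (le_trans (ler_norm_sum _ _ _))// big_distrl/=.
apply: ler_sum => j _; rewrite (le_trans (ler_norm_sum _ _ _))// big_distrl/=.
by apply: ler_sum => i _; rewrite normrM ler_wpM2l// exprmx_bound.
Qed.

Let f k := c k / Gamma (a * k%:R + 1).

Lemma ML_mx_rapid_decay : rapid_decay f.
Proof.
move=> z z0.
have [D D0 HD] := @ML_coef_bound R a 1 _ K c a0 ltr01 exprmx_rate_gt0 ML_mx_coef_bound z z0.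
have G0 k : 0 < Gamma (a * k%:R + 1) by apply: Gamma_gt0; rewrite ltr_wpDl// mulr_ge0// ltW.
by exists D => k; rewrite /f normrM normfV (gtr0_norm (G0 k)).
Qed.

Lemma ML_mx_cvg z : 0 <= z ->
  pseries f z @ \oo --> (pi *m ML_mx a 1 (z *: T) *m ones p) 0 0.
Proof.
move=> z0.
pose g i j k := (T ^+ k) i j / Gamma (a * k%:R + 1) * z ^+ k.
have cg i j : cvgn (series (g i j)).
  apply: (@ML_series_cvg R a 1 1 K) => //; first exact: exprmx_rate_gt0.
  by move=> k; rewrite mul1r exprmx_bound.
pose M : 'M[R]_p := \matrix_(i, j) limn (series (g i j)).
have zT k : (z *: T) ^+ k = z ^+ k *: T ^+ k.
  elim: k => [|k IH]; first by rewrite !expr0 scale1r.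
  rewrite !exprS IH -[LHS]/(_ *m _) -scalemxAl -scalemxAr scalerA.
  by rewrite -exprS.
have -> : ML_mx a 1 (z *: T) = M.
  apply/cvg_lim => //; apply: cvg_mx_coord => i j; rewrite mxE.
  rewrite (_ : (fun k => _) = series (g i j)); first exact: cg.
  apply/funext => n; rewrite summxE; apply: eq_bigr => k _.
  by rewrite zT !mxE /g; ring.
rewrite (_ : pseries f z = fun n => \sum_j \sum_i pi 0 i * series (g i j) n); last first.
  apply/funext => n; rewrite /pseries/series/=.
  under [RHS]eq_bigr do under eq_bigr do rewrite big_distrr/=.
  under [RHS]eq_bigr do rewrite exchange_big/=.
  rewrite exchange_big/=; apply: eq_bigr => k _.
  rewrite /f ML_mx_coefE !big_distrl/=; apply: eq_bigr => j _.
  rewrite !big_distrl/=; apply: eq_bigr => i _.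
  by rewrite /g; ring.
rewrite (_ : (pi *m M *m ones p) 0 0 = \sum_j \sum_i pi 0 i * M i j); last first.
  rewrite mxE; apply: eq_bigr => j _; rewrite [ones p j 0]mxE mulr1.
  by rewrite mxE.
apply: cvg_big => [|j _]; first exact: add_continuous.
apply: cvg_big => [|i _]; first exact: add_continuous.
by apply: cvgMr; rewrite mxE; exact: cg.
Qed.

Let F (x : R) : R := (pi *m ML_mx a 1 (x `^ a *: T) *m ones p) 0 0.
Let FE x : F x = limn (pseries f (x `^ a)).
Proof. by apply/esym/cvg_lim => //; apply: ML_mx_cvg; exact: powR_ge0. Qed.

Lemma ML_mx_continuous (x : R) : 0 < x -> {for x, continuous F}.
Proof.
move=> x0; rewrite (_ : F = (fun z : R => limn (pseries f z)) \o (fun z : R => z `^ a)); last first.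
  by apply/funext => y; rewrite FE.
apply: continuous_comp.
  apply: differentiable_continuous; apply/derivable1_diffP.
  by apply: derivable_powR; rewrite in_itv/= andbT.
exact: rapid_decay_continuous ML_mx_rapid_decay _.
Qed.

Lemma ML_mx_continuous0 : F x @[x --> 0^'+] --> F 0.
Proof.
rewrite (_ : F = (fun z : R => limn (pseries f z)) \o (fun z : R => z `^ a)); last first.
  by apply/funext => y; rewrite FE.
rewrite /= powR0 ?gt_eqF//.
apply: (@cvg_comp _ _ _ (fun z : R => z `^ a) (fun z => limn (pseries f z)) _ (nbhs (0 : R))).
  exact: powR_cvg0.
exact: rapid_decay_continuous ML_mx_rapid_decay _.
Qed.

Lemma ML_mx_0 : F 0 = \sum_i pi 0 i.
Proof.
rewrite FE powR0 ?gt_eqF//; apply/cvg_lim => //; rewrite -cvg_shiftS.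
rewrite (_ : (fun n => _) = cst (\sum_i pi 0 i)); first exact: cvg_cst.
apply/funext => n; rewrite /pseries/series/= big_nat_recl//= big1 ?addr0; last first.
  by move=> k _; rewrite expr0n/= mulr0.
rewrite expr0 mulr1 /f mulr0 add0r Gamma1 divr1 /c expr0 mulmx1 mxE.
by apply: eq_bigr => i _; rewrite [ones _ _ _]mxE mulr1.
Qed.

(** Termwise integration gives u^(-1) pi (sum of A^k) e with A = T / u^a, and K < u^a forces A^n to
    0. The sum is e - y, because (u^a - T) (e - y) = u^a e; written with [y], it matches the
    transform of the absorption time. *)
Lemma laplace_ML_mx (u : R) : 0 < u -> K < u `^ a ->
  (@lebesgue_measure R).-integrable `]0%R, +oo[ (fun x => (F x * expR (- (u * x)))%:E) /\
  (\int[@lebesgue_measure R]_(x in `]0%R, +oo[) (F x * expR (- (u * x)))%:E =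
   (u^-1 * (\sum_i pi 0 i - (pi *m (invmx ((u `^ a)%:M - T) *m (- (T *m ones p)))) 0 0))%:E)%E.
Proof.
move=> u0 Ku; have ua : 0 < u `^ a by rewrite powR_gt0.
have tF (x : R) : 0 < x -> series (fun k => c k * (x `^ (a * k%:R + 1 - 1) / Gamma (a * k%:R + 1)))
    @ \oo --> F x.
  move=> x0; have := ML_mx_cvg (powR_ge0 x a).
  rewrite /pseries (_ : (fun k => f k * _) = (fun k =>
     c k * (x `^ (a * k%:R + 1 - 1) / Gamma (a * k%:R + 1))))//.
  apply/funext => k; rewrite addrK powRrM powR_mulrn ?powR_ge0// /f; ring.
have [iF H] := @laplace_ML_series R a 1 _ K c a0 ltr01 exprmx_rate_gt0 ML_mx_coef_bound
  F u u0 Ku tF.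
split => //; apply/esym; apply: cvg_unique H => //.
apply: cvg_EFin; first exact: nearW.
pose A := (u `^ a)^-1 *: T.
have AE n : A ^+ n = (u `^ a)^-1 ^+ n *: T ^+ n.
  elim: n => [|n IH]; first by rewrite !expr0 scale1r.
  rewrite !exprS IH -[LHS]/(_ *m _) -scalemxAl -scalemxAr scalerA.
  by rewrite -exprS.
have A0 i j : (A ^+ n) i j @[n --> \oo] --> 0.
  apply: norm_cvg0.
  have q1 : `|(u `^ a)^-1 * K| < 1.
    by rewrite normrM normfV !gtr0_norm ?exprmx_rate_gt0// mulrC ltr_pdivrMr// mul1r.
  have := @cvg_geometric R 1 _ q1; rewrite -exprn_geometric => cq.
  apply: (squeeze_cvgr _ (cvg_cst 0) cq); apply: nearW => n; rewrite normr_ge0/= AE mxE.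
  rewrite normrM exprMn ger0_norm ?exprn_ge0 ?invr_ge0 ?(ltW ua)//.
  by rewrite ler_wpM2l ?exprmx_bound// exprn_ge0// invr_ge0 ltW.
have uT : (u `^ a)%:M - T \in unitmx.
  have -> : (u `^ a)%:M - T = (u `^ a) *: (1%:M - A).
    by rewrite scalerBr scalerA divff ?gt_eqF// scale1r scalemx1.
  by rewrite unitmxZ ?unitfE ?gt_eqF// unitmx_1B.
pose y := invmx ((u `^ a)%:M - T) *m (- (T *m ones p)).
have yE : ones p - y = ones p + A *m (ones p - y).
  have E : ((u `^ a)%:M - T) *m y = - (T *m ones p) by rewrite mulKVmx.
  apply: (@scalerI _ _ (u `^ a)); first by rewrite gt_eqF.
  rewrite [in RHS]scalerDr /A -scalemxAl scalerA divff ?gt_eqF// scale1r mulmxBr.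
  move: E; rewrite mulmxBl mul_scalar_mx => /eqP; rewrite subr_eq => /eqP E.
  by rewrite scalerBr E opprD opprK.
have : (u^-1 * \sum_i pi 0 i * \sum_(0 <= k < n) (A ^+ k *m ones p) i 0) @[n --> \oo] -->
    u^-1 * \sum_i pi 0 i * (ones p - y) i 0.
  apply: cvgMr; apply: cvg_big => [|i _]; first exact: add_continuous.
  by apply: cvgMr; exact: geometric_mx_cvg yE.
have -> : \sum_i pi 0 i * (ones p - y) i 0 = \sum_i pi 0 i - (pi *m y) 0 0.
  rewrite [(pi *m y) 0 0]mxE -sumrB; apply: eq_bigr => i _.
  by rewrite [(ones p - y) i 0]mxE [ones _ _ _]mxE [(- y) i 0]mxE; ring.
rewrite (_ : (fun n => u^-1 * _) = (fun n => \sum_(0 <= k < n) c k * u `^ (- (a * k%:R + 1))))//.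
apply/funext => n.
under eq_bigr do rewrite big_distrr/=.
rewrite exchange_big/= big_distrr/=; apply: eq_bigr => k _.
have -> : u `^ (- (a * k%:R + 1)) = u^-1 * (u `^ a)^-1 ^+ k.
  rewrite opprD powRD ?(gt_eqF u0) ?implybT// -mulNr powRrM powR_mulrn ?powR_ge0//.
  by rewrite (powRN u a) powR_inv1 ?(ltW u0)// mulrC.
rewrite mulrCA; congr (_ * _); rewrite /c -mulmxA [(pi *m _) 0 0]mxE big_distrl/=.
apply: eq_bigr => i _; rewrite AE -scalemxAl [in LHS]mxE; ring.
Qed.
End matrix_ML.

(** * The Laplace transform of a distribution function *)

Lemma integral_tail_expRN {R : realType} (u s : R) : 0 < u ->
  (\int[@lebesgue_measure R]_(x in `[s, +oo[) (expR (- (u * x)))%:E =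
   (u^-1 * expR (- (u * s)))%:E)%E.
Proof.
move=> u0; pose F (x : R) : R := - (u^-1 * expR (- (u * x))).
have dF x : is_derive x (1 : R) F (expR (- (u * x))).
  rewrite /F; apply: is_derive_eq.
  by rewrite /GRing.scale/= mulr1; field; rewrite gt_eqF.
have cF x : {for x, continuous F}.
  by apply: differentiable_continuous; apply/derivable1_diffP; case: (dF x).
rewrite (@ge0_continuous_FTC2y _ (fun x => expR (- (u * x))) F s 0).
- by rewrite sub0e /F -EFinN opprK.
- by move=> x _; exact: expR_ge0.
- apply: continuous_subspaceT => x.
  apply: continuous_comp; last exact: continuous_expR.
  by apply: continuousN; apply: continuousM => //; exact: cst_continuous.
- rewrite /F -oppr0 -[X in - X](mulr0 u^-1); apply: cvgN; apply: cvgMr.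
  apply: (@cvg_comp _ _ _ (fun x : R => u * x) (fun z => expR (- z)) _ (pinfty_nbhs R)).
    exact: gt0_cvgMry.
  exact: cvgr_expR.
- by move=> x _; case: (dF x).
- exact/cvg_at_right_filter/cF.
- by move=> x _; rewrite derive1E; case: (dF x).
Qed.

Lemma measurable_expeR {R : realType} : measurable_fun setT (@expeR R).
Proof.
rewrite (_ : @expeR R = fun x => if x == +oo%E then +oo%E else
    if x == -oo%E then 0%E else (expR (fine x))%:E); last first.
  by apply/funext => -[x| |].
apply: measurable_fun_ifT => //; first exact: measurable_fun_eqe.
apply: measurable_fun_ifT => //; first exact: measurable_fun_eqe.
by apply/measurable_EFinP; apply: measurableT_comp => //; exact: measurable_fine.
Qed.

Section laplace_cdf.
Context d (Omega : measurableType d) {R : realType} (P : probability Omega R).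
Variables (tau : Omega -> \bar R).
Hypothesis mtau : measurable_fun setT tau.
Hypothesis tau_fin : {ae P, forall w, (0 <= tau w < +oo)%E}.
Local Notation mu := (@lebesgue_measure R).

Lemma measurable_cdf_event (t : R) : measurable [set w | (tau w <= t%:E)%E].
Proof.
rewrite -[X in measurable X]setTI.
exact: measurable_lee mtau (measurable_cst _).
Qed.

Let A : set (Omega * R) := [set z | (tau z.1 <= z.2%:E)%E].

Let mA : measurable A.
Proof.
rewrite -[X in measurable X]setTI; apply: measurable_lee => //.
  exact: measurableT_comp.
by apply/measurable_EFinP.
Qed.

(** Tonelli on the set of pairs (w, t) with tau w <= t: for fixed w the integral of exp(-(u t)) from
    tau w on is u^(-1) exp(-(u tau w)). *)
Lemma laplace_cdf (u : R) : 0 < u ->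
  (\int[mu]_(t in `]0%R, +oo[) (fine (P [set w | (tau w <= t%:E)%E]) * expR (- (u * t)))%:E =
   (u^-1)%:E * \int[P]_w expeR (- (u%:E * tau w)))%E.
Proof.
move=> u0.
pose e (t : R) : R := \1_(`]0%R, +oo[%classic : set R) t * expR (- (u * t)).
have e0 t : 0 <= e t by rewrite mulr_ge0 ?expR_ge0.
have me : measurable_fun setT e.
  apply: measurable_funM; first exact: measurable_indic.
  by apply: measurableT_comp => //; exact: measurableT_comp.
pose g (z : Omega * R) : \bar R := (\1_A z * e z.2)%:E.
have mg : measurable_fun setT g.
  apply/measurable_EFinP; apply: measurable_funM; first exact: measurable_indic.
  exact: measurableT_comp.
have g0 z : (0 <= g z)%E by rewrite lee_fin mulr_ge0.
transitivity (\int[mu]_t \int[P]_w g (w, t))%E.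
  rewrite integral_mkcond; apply: eq_integral => t _.
  transitivity ((e t)%:E * \int[P]_w (\1_[set w | (tau w <= t%:E)%E] w)%:E)%E.
    rewrite integral_indic ?setIT//; last exact: measurable_cdf_event.
    rewrite -[X in (_ = _ * X)%E]fineK ?fin_num_measure//; last exact: measurable_cdf_event.
    rewrite patchE /e indicE; case: ifPn => _; rewrite ?mul0r ?mul0e// mul1r.
    by rewrite -EFinM mulrC.
  rewrite -ge0_integralZl//.
  - by apply: eq_integral => w _; rewrite -EFinM mulrC /g !indicE.
  - by apply/measurable_EFinP; apply: measurable_indic; exact: measurable_cdf_event.
  - by rewrite lee_fin.
rewrite -(@fubini_tonelli _ _ _ _ _ P mu g mg g0).
rewrite -ge0_integralZl//; last 3 first.
- apply: measurableT_comp; first exact: measurable_expeR.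
  by apply: measurableT_comp => //; exact: measurable_funeM.
- by move=> w _; exact: expeR_ge0.
- by rewrite lee_fin invr_ge0 ltW.
apply: ge0_ae_eq_integral => //.
- exact: (@measurable_fun_fubini_tonelli_F _ _ _ _ _ mu g mg g0).
- apply: measurable_funeM; apply: measurableT_comp; first exact: measurable_expeR.
  by apply: measurableT_comp => //; exact: measurable_funeM.
- by move=> w _; exact: integral_ge0.
- by move=> w _; rewrite mule_ge0 ?expeR_ge0// lee_fin invr_ge0 ltW.
apply: filterS tau_fin => w /andP[tw0 tw] _.
have [s s0 tws] : exists2 s : R, 0 <= s & tau w = s%:E.
  by move: tw0 tw; case: (tau w) => [s| |]// s0 _; exists s.
rewrite tws (_ : expeR _ = (expR (- (u * s)))%:E)// -EFinM -integral_tail_expRN//.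
transitivity (\int[mu]_(t in `[s, +oo[) (e t)%:E)%E.
  rewrite [RHS]integral_mkcond; apply: eq_integral => t _.
  rewrite /g patchE indicE/=; case: ifPn => [/set_mem|/negP tns].
    by rewrite /= in_itv/= andbT => st; rewrite mem_set ?mul1r// /A/= tws lee_fin.
  rewrite memNset ?mul0r// /A/= tws lee_fin => st; apply: tns; apply/mem_set.
  by rewrite /= in_itv/= st.
have mE : measurable_fun setT (fun x : R => (expR (- (u * x)))%:E).
  by apply/measurable_EFinP; apply: measurableT_comp => //; exact: measurableT_comp.
(* The end point is dropped because for s = 0 the function [e] vanishes there while the exponential
   does not. *)
rewrite -integral_itv_obnd_cbnd; last by apply/measurable_EFinP; exact: measurable_funTS.
rewrite -[RHS]integral_itv_obnd_cbnd; last by apply: measurable_funTS; exact: mE.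
apply: eq_integral => t; rewrite inE/= in_itv/= andbT => st.
by rewrite /e indicE mem_set ?mul1r//= in_itv/= andbT (le_lt_trans s0).
Qed.
End laplace_cdf.

(** * The law of the absorption time *)

Section absorption_law.
Context {R : realType} {d : measure_display} {Omega : measurableType d} (P : probability Omega R).
Context (alpha : R) {p : nat} (pi : 'rV[R]_p) (Q1 : 'M[R]_p) (q1 : 'cV[R]_p) (Q : 'M[R]_(p + 1)).
Hypothesis alpha0 : 0 < alpha.
Hypothesis hpi_sum : \sum_i pi 0 i = 1.
Hypothesis hQ : Q = block_mx Q1 q1 0 1%:M.
Hypothesis hQ_stoch : stochastic Q.
Hypothesis hQ_diag : forall i, Q1 i i = 0.
Hypothesis hQ_trans : forall i : 'I_p, transient Q (lshift 1 i).
Variables (lam : 'I_p -> R) (T : 'M[R]_p) (t : 'cV[R]_p).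
Hypothesis hlam : forall i, 0 < lam i.
Hypothesis hLambda : intensity_matrix lam Q = block_mx T t 0 0.
Variable Y : nat -> Omega -> 'I_(p + 1).
Hypothesis hY : markov_chain P Q Y.
Hypothesis hY0 : forall i : 'I_p, P (Y 0%N @^-1` [set lshift 1 i]) = (pi 0 i)%:E.
Variable W : 'I_p -> nat -> {RV P >-> R}.
Hypothesis hW : forall i n, has_ML_density alpha (lam i) (W i n).
Hypothesis hindep : mutually_independent P (sojourn_chain_sigma W Y).

Local Notation tau := (absorption_time (fun i n => W i n : Omega -> R) Y).
Local Notation E k := (absorbed_after Y 0 k).

Let mY n i : measurable (Y n @^-1` [set i]). Proof. by case: hY. Qed.
Let mE k : measurable (E k). Proof. exact: measurable_absorbed_after hY _ _. Qed.

Let integral_split_Y0 (f : Omega -> R) : measurable_fun setT f -> (forall w, 0 <= f w) ->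
  (\int[P]_w (f w)%:E = \sum_j \int[P]_w (\1_(Y 0%N @^-1` [set j]) w * f w)%:E)%E.
Proof.
move=> mf f0; rewrite -ge0_integral_sum//; last 2 first.
- by move=> j; apply/measurable_EFinP; apply: measurable_funM => //; exact: measurable_indic.
- by move=> j w _; rewrite lee_fin mulr_ge0.
apply: eq_integral => w _; rewrite sumEFin -big_distrl/=; congr EFin.
rewrite (bigD1 (Y 0%N w))//= big1 ?addr0; last first.
  by move=> j jY; rewrite indicE memNset//= => e; rewrite e eqxx in jY.
by rewrite indicE mem_set// mul1r.
Qed.

Let Y0_absorbing : P (Y 0%N @^-1` [set absorbing p]) = 0%E.
Proof.
have := @integral_split_Y0 (cst 1) (measurable_cst _) (fun=> ler01).
have I j : (\int[P]_w (\1_(Y 0%N @^-1` [set j]) w * cst 1 w)%:E = P (Y 0%N @^-1` [set j]))%E.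
  under eq_integral do rewrite /= mulr1.
  by rewrite integral_indic// setIT.
under eq_bigr do rewrite I.
rewrite /= integral_cst//= probability_setT mule1 big_split_ord/= big_ord1.
under eq_bigr do rewrite hY0.
rewrite sumEFin hpi_sum -[P _]fineK ?fin_num_measure// -EFinD => e; have h := EFin_inj e.
by congr EFin; apply: (addrI 1); rewrite -h addr0.
Qed.

(** A filler state: a prefix of length 0 still has to be given as a function into ['I_p]. *)
Let p_inh : 'I_p.
Proof.
move: pi hpi_sum; case: (p) => [|n] v; last by move=> _; exact: ord0.
by rewrite big_ord0 => /esym/eqP; rewrite oner_eq0.
Qed.

Section laplace.
Variables (u : R) (u0 : 0 <= u).
Let h (x : R) := expR (- (u * x)).
Let phi i := lam i / (u `^ alpha + lam i).

Let mh : measurable_fun setT h.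
Proof. by apply: measurableT_comp => //; exact: measurableT_comp. Qed.
Let h0 x : 0 <= h x. Proof. exact: expR_ge0. Qed.
Let hphi i k : (\int[P]_w (h (W i k w))%:E = (phi i)%:E)%E.
Proof. exact: (ML_law_laplace alpha0 (hlam i) (hW i k) u0). Qed.

Definition laplace_factor k w : R := \prod_(m < k) sojourn_factor W h (Y m w) m w.

Lemma laplace_factor_ge0 k w : 0 <= laplace_factor k w.
Proof.
apply: prodr_ge0 => m _; rewrite /sojourn_factor.
by case: fintype.split => // i; exact: h0.
Qed.

Lemma measurable_laplace_factor k : measurable_fun setT (laplace_factor k).
Proof.
apply: measurable_prod => m _.
apply: (@measurable_fun_finite_case _ _ _ _ _ (Y m) (fun j => sojourn_factor W h j m)) => // j.
rewrite /sojourn_factor; case: fintype.split => // i.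
by apply: measurableT_comp; [exact: mh|exact: measurable_funPT].
Qed.

Lemma expectation_absorbed_at k :
  (\int[P]_w (\1_(E k) w * laplace_factor k w)%:E =
   (\sum_i pi 0 i * absorption_weight Q phi k (lshift 1 i))%:E)%E.
Proof.
rewrite integral_split_Y0; last 2 first.
- by apply: measurable_funM; [exact: measurable_indic|exact: measurable_laplace_factor].
- by move=> w; rewrite mulr_ge0 ?laplace_factor_ge0.
have I j : (\int[P]_w (\1_(Y 0%N @^-1` [set j]) w * (\1_(E k) w * laplace_factor k w))%:E =
    (fine (P (Y 0%N @^-1` [set j])) * absorption_weight Q phi k j)%:E)%E.
  pose s (m : nat) := p_inh.
  have Yj : Y 0%N @^-1` [set j] = path_event Y 0 s j.
    by apply/seteqP; split => [w /= H|w []].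
  have := hitting_expectation hindep hY mh h0 hphi k 0 s j.
  rewrite big_ord0 mul1r -Yj => <-.
  by apply: eq_integral => w _; rewrite mulrA indicI.
under eq_bigr do rewrite I.
rewrite sumEFin big_split_ord/= big_ord1 -/(absorbing p) Y0_absorbing /= mul0r addr0.
by congr EFin; apply: eq_bigr => i _; rewrite hY0.
Qed.

Let y := invmx ((u `^ alpha)%:M - T) *m (- (T *m ones p)).

Lemma series_absorbed_at :
  (\sum_(0 <= k <oo) \int[P]_w (\1_(E k) w * laplace_factor k w)%:E = ((pi *m y) 0 0)%:E)%E.
Proof.
apply/cvg_lim => //.
under eq_fun => n do under eq_bigr => k _ do rewrite expectation_absorbed_at.
under eq_fun do rewrite sumEFin.
apply: cvg_EFin; first exact: nearW.
exact: (absorption_weight_sum hQ hQ_stoch hQ_diag hQ_trans hlam hLambda (powR_ge0 u alpha)).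
Qed.
End laplace.

Let E_disjoint i j w : E i w -> E j w -> i = j.
Proof.
move=> [Hi ei] [Hj ej]; case: (ltngtP i j) => // ij; exfalso.
- exact: (Hj _ ij ei).
- exact: (Hi _ ij ej).
Qed.

(** At u = 0 all Laplace factors are 1, so the series of [series_absorbed_at] adds up the
    probabilities of absorption at step k; its value is pi (-T)^(-1) (-T e) = pi e = 1. *)
Lemma ae_absorbed : {ae P, forall w, exists k, E k w}.
Proof.
have P1 : P (\bigcup_k E k) = 1%E.
  rewrite measure_bigcup//; last first.
    by apply/trivIsetP => i j _ _ ij; apply/seteqP; split => // w [/E_disjoint/[apply]] /eqP; rewrite (negbTE ij).
  transitivity (\sum_(0 <= k <oo) \int[P]_w (\1_(E k) w * laplace_factor 0 k w)%:E)%E.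
    rewrite (@eq_eseriesl _ _ xpredT); last by move=> k; rewrite in_setT.
    apply: eq_eseriesr => k _.
    transitivity (\int[P]_w (\1_(E k) w)%:E)%E; first by rewrite integral_indic// setIT.
    apply: eq_integral => w _; rewrite /laplace_factor big1 ?mulr1// => m _.
    by rewrite /sojourn_factor; case: fintype.split => // i; rewrite mul0r oppr0 expR0.
  rewrite series_absorbed_at// powR0 ?gt_eqF// raddf0 sub0r.
  have -> : invmx (- T) *m - (T *m ones p) = ones p.
    rewrite -mulNmx mulKmx//.
    have := resolvent_unitmx hQ hQ_stoch hQ_diag hQ_trans hlam hLambda (lexx 0).
    by rewrite raddf0 sub0r.
  rewrite mxE -hpi_sum; congr EFin; apply: eq_bigr => i _.
  by rewrite [ones _ _ _]mxE mulr1.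
exists (~` \bigcup_k E k); split.
- by apply: measurableC; exact: bigcup_measurable.
- rewrite probability_setC ?P1 ?subee//; exact: bigcup_measurable.
- by move=> w /= H [k _ Ek]; apply: H; exists k.
Qed.

Lemma ae_sojourn_gt0 : {ae P, forall w, forall i n, 0 < W i n w}.
Proof.
have H i n : {ae P, forall w, 0 < W i n w}.
  exists [set w | W i n w <= 0]; split.
  - rewrite (_ : [set w | _] = W i n @^-1` `]-oo, 0]); last first.
      by apply/seteqP; split => w /=; rewrite in_itv.
    by rewrite -[X in measurable X]setTI; exact: measurable_funPT.
  - exact: (ML_law_le0 (hW i n)).
  - by move=> w /= /negP; rewrite -leNgt.
by apply: filter_forall => i; apply: ae_foralln => n; exact: H.
Qed.

Let mtau : measurable_fun setT tau.
Proof. by apply: measurable_absorption_time => // i n; exact: measurable_funPT. Qed.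

Let tauE k w : E k w -> (forall i n, 0 < W i n w) ->
  exists2 s : R, tau w = s%:E & (forall u, expR (- (u * s)) = laplace_factor u k w) /\ 0 <= s.
Proof.
move=> Ek W0; pose s := \sum_(m < k) fine (sojourn (fun i n => W i n : Omega -> R) (Y m w) m w).
exists s.
  by rewrite (absorption_time_absorbed Ek) ?jump_time_absorbed// => i n; exact: ltW.
have Ym (m : 'I_k) : exists i, Y m w = lshift 1 i.
  case: (fintype.splitP (Y m w)) => [i Yi|o Yo]; first by exists i; apply: val_inj.
  have [/(_ _ (ltn_ord m)) H _] := Ek; exfalso; apply: H; apply: val_inj.
  by rewrite add0n /= Yo (ord1 o).
have sl i : fintype.split (lshift 1 i : 'I_(p + 1)) = inl i by exact: (unsplitK (inl i)).
split; last first.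
  apply: sumr_ge0 => m _; rewrite /sojourn; have [i ->] := Ym m.
  by rewrite sl /= ltW.
move=> u; rewrite /s big_distrr/= -sumrN expR_sum; apply: eq_bigr => m _.
by rewrite /sojourn /sojourn_factor; have [i ->] := Ym m; rewrite sl.
Qed.

Lemma ae_absorption_time : {ae P, forall w, (0 <= tau w < +oo)%E}.
Proof.
apply: filterS2 ae_absorbed ae_sojourn_gt0 => w [k Ek] W0.
by have [s -> [_ s0]] := tauE Ek W0; rewrite lee_fin s0 ltry.
Qed.

Lemma absorption_time_laplace (u : R) : 0 <= u ->
  (\int[P]_w expeR (- (u%:E * tau w)) =
   ((pi *m (invmx ((u `^ alpha)%:M - T) *m (- (T *m ones p)))) 0 0)%:E)%E.
Proof.
move=> u0.
have f0 k w : 0 <= laplace_factor u k w by exact: laplace_factor_ge0.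
have mf k : measurable_fun setT (fun w => (\1_(E k) w * laplace_factor u k w)%:E).
  apply/measurable_EFinP; apply: measurable_funM; first exact: measurable_indic.
  exact: measurable_laplace_factor.
rewrite -series_absorbed_at// -integral_nneseries//; last first.
  by move=> k w _; rewrite lee_fin mulr_ge0.
apply: ge0_ae_eq_integral => //.
- apply: measurableT_comp; first exact: measurable_expeR.
  by apply: measurableT_comp => //; exact: measurable_funeM.
- by apply: ge0_emeasurable_sum => // k w _ _; rewrite lee_fin mulr_ge0.
- by move=> w _; exact: expeR_ge0.
- by move=> w _; apply: nneseries_ge0 => k _ _; rewrite lee_fin mulr_ge0.
apply: filterS2 ae_absorbed ae_sojourn_gt0 => w [k Ek] W0 _.
have [s -> [sE _]] := tauE Ek W0.
(* The events of absorption at different steps are disjoint, so a single term of the series survives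
   at w. *)
rewrite (nneseriesD1 (n := k))//; last by move=> j _; rewrite lee_fin mulr_ge0.
rewrite eseries0 ?adde0; last first.
  move=> j _ jk; rewrite indicE memNset ?mul0r// => Ej.
  by rewrite (E_disjoint Ej Ek) eqxx in jk.
by rewrite indicE mem_set// mul1r -sE.
Qed.

Let H (x : R) : R := (pi *m ML_mx alpha 1 (x `^ alpha *: T) *m ones p) 0 0.
Let F (x : R) : R := fine (P [set w | (tau w <= x%:E)%E]).

Lemma absorption_time_cdf (x : R) : 0 <= x ->
  P [set w | (tau w <= x%:E)%E] = (1 - H x)%:E.
Proof.
have mA y : measurable [set w | (tau w <= y%:E)%E] by exact: measurable_cdf_event.
(* [v] is a threshold beyond which K < u^alpha, so that the matrix series may be integrated termwise
   for every u >= v. *)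
pose K := exprmx_rate T; pose v := (2 * K) `^ alpha^-1.
have K0 : 0 < K := exprmx_rate_gt0 T.
have v0 : 0 < v by rewrite powR_gt0 ?mulr_gt0.
have Kv u : v <= u -> K < u `^ alpha.
  move=> vu; apply: (@lt_le_trans _ _ (2 * K)); first by rewrite mulr_natl mulr2n ltrDl.
  have l2 : 0 <= 2 * K by rewrite mulr_ge0// ltW.
  rewrite -[leLHS](powRr1 l2) -[X in _ `^ X](@mulVf _ alpha) ?gt_eqF//.
  by rewrite powRrM ge0_ler_powR ?nnegrE ?powR_ge0 ?(ltW alpha0)// (le_trans (ltW v0)).
have vpos u : v <= u -> 0 < u by exact: lt_le_trans.
pose G x := 1 - H x.
pose mu := @lebesgue_measure R.
have iexp u : 0 < u -> mu.-integrable `]0%R, +oo[ (fun x => (expR (- (u * x)))%:E).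
  move=> u0; apply/integrableP; split.
    by apply/measurable_EFinP; apply: measurable_funTS; apply: measurableT_comp => //; exact: measurableT_comp.
  under eq_integral do rewrite gee0_abs ?lee_fin ?expR_ge0//.
  by rewrite integral_half_line_expRN// ltry.
have F01 y : 0 <= F y <= 1.
  by rewrite fine_ge0//= -lee_fin fineK ?fin_num_measure// probability_le1.
have Fnd0 y z : y <= z -> F y <= F z.
  move=> yz; apply: fine_le; rewrite ?fin_num_measure//.
  by apply: le_measure; rewrite ?inE// => w /= /le_trans; apply; rewrite lee_fin.
have Fnd y z (_ : 0 <= y) := @Fnd0 y z.
have iH u : v <= u -> mu.-integrable `]0%R, +oo[ (fun x => (G x * expR (- (u * x)))%:E) /\
   (\int[mu]_(x in `]0%R, +oo[) (G x * expR (- (u * x)))%:E =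
    (u^-1 * (pi *m (invmx ((u `^ alpha)%:M - T) *m (- (T *m ones p)))) 0 0)%:E)%E.
  move=> vu; have u0 := vpos _ vu.
  have [i1 I1] := laplace_ML_mx pi alpha0 u0 (Kv _ vu).
  have GE z : (G z * expR (- (u * z)))%:E = ((expR (- (u * z)))%:E - (H z * expR (- (u * z)))%:E)%E.
    by rewrite -EFinB /G mulrBl mul1r.
  split.
    have := @integrableB _ _ _ mu `]0%R, +oo[%classic (measurable_itv _) _ _ (iexp u u0) i1.
    by apply: eq_integrable => // y _; rewrite GE.
  under eq_integral do rewrite GE.
  rewrite integralB//; last exact: iexp.
  rewrite I1 integral_half_line_expRN// -EFinB hpi_sum; congr EFin; ring.
have mF : measurable_fun (`]0%R, +oo[%classic : set R) F by apply: nondecreasing_measurable => // y z; exact: Fnd0.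
have iF : mu.-integrable `]0%R, +oo[ (fun x => (F x * expR (- (v * x)))%:E).
  apply: le_integrable (iexp v v0) => //.
    apply/measurable_EFinP; apply: measurable_funM => //.
    by apply: measurable_funTS; apply: measurableT_comp => //; exact: measurableT_comp.
  move=> y _; rewrite lee_fin normrM ler_piMl//.
  by have /andP[? ?] := F01 y; rewrite ger0_norm.
have FG u : v <= u -> (\int[mu]_(x in `]0%R, +oo[) (F x * expR (- (u * x)))%:E =
   \int[mu]_(x in `]0%R, +oo[) (G x * expR (- (u * x)))%:E)%E.
  move=> vu; have u0 := vpos _ vu; have [_ ->] := iH _ vu.
  rewrite (laplace_cdf mtau ae_absorption_time u0) absorption_time_laplace ?ltW//.
have Gc y : 0 < y -> {for y, continuous G}.
  by move=> y0; apply: cvgB; [exact: cvg_cst|exact: ML_mx_continuous].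
have Gc0 : G y @[y --> 0^'+] --> G 0.
  by apply: cvgB; [exact: cvg_cst|exact: ML_mx_continuous0].
have PE y : P [set w | (tau w <= y%:E)%E] = (F y)%:E by rewrite fineK ?fin_num_measure.
have [iG _] := iH v (lexx v).
rewrite PE le_eqVlt => /predU1P[<-|x0]; last first.
  by congr EFin; exact: (laplace_unique_eq v0 iF iG FG Fnd Gc Gc0).
(* At 0 uniqueness gives only one inequality; the other holds because 1 - H 0 = 0 and a probability
   is nonnegative. *)
congr EFin; apply/eqP; rewrite eq_le (laplace_unique_le v0 iF iG FG Fnd Gc Gc0)//=.
have /andP[+ _] := F01 0; apply: le_trans.
by rewrite /H ML_mx_0// hpi_sum subrr.
Qed.
End absorption_law.

Theorem theorem4p6 (R : realType) (d : measure_display)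
  (Omega : measurableType d) (P : probability Omega R)
  (alpha : R) (halpha : 0 < alpha <= 1)
  (p : nat)
  (pi : 'rV[R]_p) (hpi_ge0 : forall i, 0 <= pi 0 i) (hpi_sum : \sum_i pi 0 i = 1)
  (Q1 : 'M[R]_p) (q1 : 'cV[R]_p) (Q : 'M[R]_(p + 1))
  (hQ : Q = block_mx Q1 q1 0 1%:M)
  (hQ_stoch : stochastic Q)
  (hQ_diag : forall i, Q1 i i = 0)
  (hQ_trans : forall i : 'I_p, transient Q (lshift 1 i))
  (lam : 'I_p -> R) (hlam : forall i, 0 < lam i)
  (T : 'M[R]_p) (t : 'cV[R]_p)
  (hLambda : intensity_matrix lam Q = block_mx T t 0 0)
  (Y : nat -> Omega -> 'I_(p + 1))
  (hY : markov_chain P Q Y)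
  (hY0 : forall i : 'I_p, P (Y 0%N @^-1` [set lshift 1 i]) = (pi 0 i)%:E)
  (W : 'I_p -> nat -> {RV P >-> R})
  (hW : forall i n, has_ML_density alpha (lam i) (W i n))
  (hindep : mutually_independent P (sojourn_chain_sigma W Y)) :
  let tau := absorption_time (fun i n => W i n : Omega -> R) Y in
  is_MML P alpha pi T tau /\
  (forall u : R, 0 <= u ->
     P [set w | (tau w <= u%:E)%E] =
     (1 - (pi *m ML_mx alpha 1 (u `^ alpha *: T) *m ones p) 0 0)%:E).
Proof.
have /andP[alpha0 _] := halpha.
have mY n i : measurable (Y n @^-1` [set i]) by case: hY.
split; last first.
  move=> u u0.
  exact: (absorption_time_cdf alpha0 hpi_sum hQ hQ_stoch hQ_diag hQ_trans hlam hLambda hY hY0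
    hW hindep u0).
split.
- by apply: measurable_absorption_time => // i n; exact: measurable_funPT.
- exact: (ae_absorption_time alpha0 hpi_sum hQ hQ_stoch hQ_diag hQ_trans hlam hLambda hY hY0
    hW hindep).
- move=> u u0; split.
    exact: (resolvent_unitmx hQ hQ_stoch hQ_diag hQ_trans hlam hLambda (powR_ge0 u alpha)).
  rewrite -mulmxA.
  exact: (absorption_time_laplace alpha0 hpi_sum hQ hQ_stoch hQ_diag hQ_trans hlam hLambda
    hY hY0 hW hindep u0).
Qed.
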